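(* Let $Q \in SO(3)$. The inclusion $i_Q: X_Q \to Y_Q$ is homotopically surjective, in the following precise sense: for any compact space $K$ and any continuous function $f: K \to Y_Q$ there exist a continuous function $g: K \to X_Q$ and a continuous homotopy $H: [0,1] \times K \to Y_Q$ with $H(0,\cdot) = f$ and $H(1,\cdot) = g$ (where $g$ is regarded as a map to $Y_Q$ via $X_Q \subset Y_Q$).
   Context: $\mathbb{S}^2 \subset \mathbb{R}^3$ is the unit sphere and $e_1,e_2,e_3$ is the canonical basis of $\mathbb{R}^3$. A curve $\gamma: [0,1] \to \mathbb{S}^2$ is locally convex if its geodesic curvature is always positive, i.e. $\det(\gamma(t),\gamma'(t),\gamma''(t)) > 0$ for all $t \in [0,1]$. For $Q \in SO(3)$, $Y_Q$ is the space of parametrized curves $\gamma: [0,1] \to \mathbb{S}^2$ with $\gamma'(t) \ne 0$ for all $t$, $\gamma(0) = e_1$, $\gamma'(0) = c_0 e_2$, $\gamma(1) = Qe_1$, $\gamma'(1) = c_1 Qe_2$ for some $c_0, c_1 > 0$ (depending on $\gamma$). $X_Q \subset Y_Q$ is the subspace of locally convex curves. The topology on these spaces of curves can be taken to be $C^\infty$, $C^k$ ($k \ge 2$) or Sobolev $H^k$ ($k \ge 2$); the choice is immaterial since curves can be smoothed while keeping the geodesic curvature positive. *)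

(* Defs.v *)
From HB Require Import structures.
From mathcomp Require Import all_boot all_order all_algebra.
From mathcomp Require Import all_classical all_reals all_analysis.

Set Implicit Arguments.
Unset Strict Implicit.
Unset Printing Implicit Defensive.

Import Order.TTheory GRing.Theory Num.Theory.
Import numFieldNormedType.Exports.

Local Open Scope classical_set_scope.
Local Open Scope ring_scope.

(* [set_type] carries the subspace topology, so [unit_itv R] is the topological
   space [0, 1] and limits in it are one-sided at the endpoints. *)
Definition unit_itv (R : realType) : Type := set_type (`[0, 1]%classic : set R).
HB.instance Definition _ (R : realType) := Topological.copy (unit_itv R)
  (set_type (`[0, 1]%classic : set R)).

Lemma I0_subproof (R : realType) : (0 : R) \in (`[0, 1]%classic : set R).
Proof. by rewrite inE /= in_itv /= lexx ler01. Qed.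

Lemma I1_subproof (R : realType) : (1 : R) \in (`[0, 1]%classic : set R).
Proof. by rewrite inE /= in_itv /= lexx ler01. Qed.

Definition I0 (R : realType) : unit_itv R := exist _ 0 (I0_subproof R).
Definition I1 (R : realType) : unit_itv R := exist _ 1 (I1_subproof R).

(* Regularity classes: [Some k] stands for C^k and [None] for C^oo. *)
Definition reg_le (j : nat) (r : option nat) : bool :=
  if r is Some k then (j <= k)%N else true.

Definition diff_quotient (R : realType) (c : unit_itv R -> 'cV[R]_3)
    (t s : unit_itv R) : 'cV[R]_3 :=
  (set_val s - set_val t)^-1 *: (c s - c t).

Definition curve_derivable (R : realType) (c : unit_itv R -> 'cV[R]_3)
    (t : unit_itv R) : Prop :=
  cvg (diff_quotient c t s @[s --> t^']).

(* Only meaningful at points where [curve_derivable] holds. *)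
Definition curve_derive (R : realType) (c : unit_itv R -> 'cV[R]_3) :
    unit_itv R -> 'cV[R]_3 :=
  fun t => lim (diff_quotient c t s @[s --> t^']).

Definition curve_derive_n (R : realType) (j : nat) (c : unit_itv R -> 'cV[R]_3) :
    unit_itv R -> 'cV[R]_3 :=
  iter j (@curve_derive R) c.

Definition Cr (R : realType) (r : option nat) : set (unit_itv R -> 'cV[R]_3) :=
  [set c | (forall j, reg_le j.+1 r ->
              forall t, curve_derivable (curve_derive_n j c) t) /\
           (forall j, reg_le j r -> continuous (curve_derive_n j c))].

Definition Cr_space (R : realType) (r : option nat) : Type :=
  set_type (@Cr R r).

HB.instance Definition _ (R : realType) (r : option nat) :=
  gen_eqMixin (Cr_space R r).
HB.instance Definition _ (R : realType) (r : option nat) :=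
  gen_choiceMixin (Cr_space R r).

Definition jet (R : realType) (r : option nat) (c : Cr_space R r) :
    prod_topology
      (fun _ : {j : nat | reg_le j r} => {uniform unit_itv R -> 'cV[R]_3}) :=
  fun j => curve_derive_n (sval j) (sval c).

(* The C^r topology: uniform convergence of each derivative of order at most
   r (every finite order if r = oo). *)
HB.instance Definition _ (R : realType) (r : option nat) :=
  Topological.copy (Cr_space R r) (initial_topology (@jet R r)).

Definition sphere (R : realType) : set 'cV[R]_3 :=
  [set u | \sum_(i < 3) u i 0 ^+ 2 = 1].

Definition SO3 (R : realType) : set 'M[R]_3 :=
  [set Q | Q^T *m Q = 1%:M /\ \det Q = 1].

(* Indices in ['I_3] start at 0. *)
Definition e1 (R : realType) : 'cV[R]_3 := delta_mx 0 0.
Definition e2 (R : realType) : 'cV[R]_3 := delta_mx 1 0.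

Definition YQ (R : realType) (r : option nat) (Q : 'M[R]_3) :
    set (Cr_space R r) :=
  [set x | let c := sval x in let c' := curve_derive c in
    [/\ (forall t, sphere (c t)),
        (forall t, c' t <> 0),
        (c (I0 R) = e1 R /\
           exists c0 : R, 0 < c0 /\ c' (I0 R) = c0 *: e2 R) &
        (c (I1 R) = Q *m e1 R /\
           exists c1 : R, 0 < c1 /\ c' (I1 R) = c1 *: (Q *m e2 R))]].

Arguments YQ {R} r Q.

Definition locally_convex (R : realType) (c : unit_itv R -> 'cV[R]_3) : Prop :=
  forall t, 0 < \det (row_mx (c t)
    (row_mx (curve_derive c t) (curve_derive (curve_derive c) t)) : 'M[R]_3).

(* A set of points of the space [YQ r Q], so that [XQ r Q] carries the topology
   induced by [YQ r Q] and the inclusion is [set_val]. *)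
Definition XQ (R : realType) (r : option nat) (Q : 'M[R]_3) : set (YQ r Q) :=
  [set y | locally_convex (sval (sval y))].

Arguments XQ {R} r Q.

Definition iQ (R : realType) (r : option nat) (Q : 'M[R]_3) (x : XQ r Q) :
    YQ r Q := set_val x.

(* Main.v *)
(* A curve c of the family is replaced by the telephone wire
     y(t) = a1 c + a2 b + a3 (c x b),   a = a(s, 2 pi N t),
   pushed back to the sphere by y / |y|.  Here b is a Bernstein polynomial of c',
   so that b . c' > 0 and b = c' at both ends while c, b and c x b have all the
   derivatives of c.  The closed curve a(s, .) starts at the constant e1; for
   s <= 1/2 it is the ground track of a geosynchronous satellite whose inclination
   grows from 0 (a point), through figure eights, to pi (the equator run through
   twice); for s >= 1/2 the doubled equator is lifted to a locally convex doubled
   circle.  A moving vector g satisfies det(a, a', g) >= 0, with equality only at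
   s = 0, where the wire is c itself; by compactness y and y' are independent for
   all s as soon as N is large, and at s = 1 the wire is locally convex. *)

Require Import Defs.
From mathcomp Require Import all_boot all_order all_algebra.
From mathcomp Require Import all_classical all_reals all_analysis.
From mathcomp Require Import ring lra.
Import Order.TTheory GRing.Theory Num.Theory.
Import numFieldNormedType.Exports.
Local Open Scope classical_set_scope.
Local Open Scope ring_scope.

Set Implicit Arguments.
Unset Strict Implicit.
Unset Printing Implicit Defensive.

(** The frame (c, c', c x c') would cost one derivative and leave C^r; this is why b replaces c'. A
    small circle growing from a point would not do as the coil: while it is small, the fast loop and
    the slow motion along c have comparable speeds and can cancel in a cusp. With the ground track,
    det(y, y', g) is a nonnegative multiple of N plus a remainder that is positive wherever the
    multiple vanishes, so the two never compete. The doubled equator has a topological origin. The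
    pairs (a, g) form loops of frames that start at the constant (e1, e3), so the final loop must be
    trivial in pi_1(SO(3)) = Z/2; an equator run once with g = e3 is not. In the satellite picture
    the two turns come from a retrograde orbit seen from a planet rotating the other way. Convexity
    at s = 1 is inherited from a, since om^3 det(a, a', a'') dominates, and radial projection
    multiplies the determinant by a positive factor. *)

Lemma itv_ge0 (R : realType) (t : unit_itv R) : 0 <= set_val t.
Proof. by have := set_valP t; rewrite /= in_itv /= => /andP[]. Qed.

Lemma itv_le1 (R : realType) (t : unit_itv R) : set_val t <= 1.
Proof. by have := set_valP t; rewrite /= in_itv /= => /andP[]. Qed.

Lemma itv_inj (R : realType) (s t : unit_itv R) : set_val s = set_val t -> s = t.
Proof. exact: val_inj. Qed.

Lemma clamp_subproof (R : realType) (x : R) :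
  Num.max 0 (Num.min x 1) \in (`[0, 1]%classic : set R).
Proof. by rewrite inE /= in_itv /= le_max lexx ge_max ler01 ge_min lexx orbT. Qed.

Definition clamp (R : realType) (x : R) : unit_itv R :=
  exist _ (Num.max 0 (Num.min x 1)) (clamp_subproof x).

Lemma val_clamp (R : realType) (x : R) :
  set_val (clamp x) = Num.max 0 (Num.min x 1).
Proof. by []. Qed.

Lemma clampE (R : realType) (x : R) : 0 <= x <= 1 -> set_val (clamp x) = x.
Proof. by move=> /andP[x0 x1]; rewrite val_clamp min_l// max_r. Qed.

Lemma clampK (R : realType) (t : unit_itv R) : clamp (set_val t) = t.
Proof. by apply: itv_inj; rewrite clampE// itv_ge0 itv_le1. Qed.

Lemma clamp_dist (R : realType) (x : R) (t : unit_itv R) :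
  (set_val (clamp x) - set_val t) ^+ 2 <= (x - set_val t) ^+ 2.
Proof.
have := itv_ge0 t; have := itv_le1 t; rewrite val_clamp.
move: (set_val t) => y y1 y0; have [x1|x1] := leP x 1.
  by have [x0|x0] := leP 0 x; nra.
by have [x0|x0] := leP (0 : R) 1; nra.
Qed.

Lemma continuous_itv_val (R : realType) : continuous (fun t : unit_itv R => set_val t : R).
Proof. exact: initial_continuous. Qed.

Lemma continuous_clamp (R : realType) : continuous (@clamp R).
Proof.
apply: (@continuous_comp_initial _ _ R (set_val : unit_itv R -> R)).
have h : continuous ((fun=> 0 : R) \max (id \min (fun=> 1 : R))).
  apply: max_fun_continuous; first by move=> ?; exact: cvg_cst.
  by apply: min_fun_continuous; [move=> ?; exact: cvg_id|move=> ?; exact: cvg_cst].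
exact: h.
Qed.

Lemma compact_itv (R : realType) : compact [set: unit_itv R].
Proof.
have -> : [set: unit_itv R] = @clamp R @` `[0, 1].
  apply/seteqP; split=> // t _; exists (set_val t); last exact: clampK.
  by rewrite /= in_itv /= itv_ge0 itv_le1.
apply: continuous_compact; last exact: segment_compact.
exact/continuous_subspaceT/continuous_clamp.
Qed.

(** No point of the interval is isolated, endpoints included; this is what makes limits of
    difference quotients, hence derivatives, unique. *)
Lemma itv_dnbhs_proper (R : realType) (t : unit_itv R) : ProperFilter t^'.
Proof.
split; last exact: dnbhs_filter.
rewrite /dnbhs /within /= => t0.
have : \forall x \near (set_val t : R), clamp x = t.
  have := @continuous_clamp R (set_val t : R) [set s | s = t]; rewrite clampK; apply.
  by apply: filterS t0 => s /= st; apply: contrapT => /eqP.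
move=> /nbhs_ballP[e /= e0] he.
(* Stepping up from the left half and down from the right half, by at most one half, never leaves
   the interval, so [clamp] fixes [x] and cannot send it to [t]. *)
pose x := if (set_val t : R) < 2^-1 then set_val t + Num.min (e / 2) 2^-1
          else set_val t - Num.min (e / 2) 2^-1.
have hm : 0 < Num.min (e / 2) 2^-1 by rewrite lt_min; apply/andP; split; lra.
have hm1 : Num.min (e / 2) 2^-1 <= e / 2 by rewrite ge_min lexx.
have hm2 : Num.min (e / 2) 2^-1 <= 2^-1 by rewrite ge_min lexx orbT.
have t0' := itv_ge0 t; have t1 := itv_le1 t.
have : ball (set_val t : R) e x.
  rewrite /ball /= /x; move: (set_val t) (Num.min _ _) hm hm1 => u m *.
  by case: ifP => _; rewrite ltr_norml; apply/andP; split; lra.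
move=> /he /(congr1 set_val); rewrite clampE.
  rewrite /x; move: (set_val t) (Num.min _ _) hm => u m ? /=.
  by case: ifP => _ /eqP; rewrite eq_sym -subr_eq0 ?opprB ?opprD => /eqP; lra.
rewrite /x; move: t0' t1 (Num.min _ _) hm hm2; move: (set_val t) => u ? ? m ? ?.
by case: ltP => ?; apply/andP; split; lra.
Qed.

(** * Continuity combinators and differentiation on the interval *)

Lemma continuousZ_fun (R : realType) (X : topologicalType) (V : normedModType R)
  (k : X -> R) (f : X -> V) :
  continuous k -> continuous f -> continuous (fun x => k x *: f x).
Proof. by move=> ck cf x; apply: cvgZ; [exact: ck|exact: cf]. Qed.

Lemma continuousD_fun (R : realType) (X : topologicalType) (V : normedModType R)
  (f g : X -> V) :
  continuous f -> continuous g -> continuous (fun x => f x + g x).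
Proof. by move=> cf cg x; apply: cvgD; [exact: cf|exact: cg]. Qed.

Lemma continuousM_fun (R : realType) (X : topologicalType) (f g : X -> R) :
  continuous f -> continuous g -> continuous (fun x => f x * g x).
Proof. by move=> cf cg x; apply: cvgM; [exact: cf|exact: cg]. Qed.

Lemma continuous_pair (X Y Z : topologicalType) (f : X -> Y) (g : X -> Z) :
  continuous f -> continuous g -> continuous (fun x => (f x, g x)).
Proof. by move=> cf cg x; apply: cvg_pair; [exact: cf|exact: cg]. Qed.

Lemma continuous_after (X Y Z : topologicalType) (f : Y -> Z) (g : X -> Y) :
  continuous f -> continuous g -> continuous (fun x => f (g x)).
Proof. by move=> cf cg x; apply: continuous_comp; [exact: cg|exact: cf]. Qed.

Lemma contD_at (R : realType) (X : topologicalType) (V : normedModType R)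
  (f g : X -> V) x : {for x, continuous f} -> {for x, continuous g} ->
  {for x, continuous (fun y => f y + g y)}.
Proof. exact: continuousD. Qed.

(* [f'] is the (one-sided at the endpoints) derivative of [f], in Caratheodory's form. *)
Definition ider (R : realType) (V : normedModType R) (f f' : unit_itv R -> V) : Prop :=
  forall t, exists q : unit_itv R -> V,
    [/\ {for t, continuous q}, q t = f' t &
        forall s, f s - f t = (set_val s - set_val t) *: q s].

Section Ider.
Variables (R : realType).
Implicit Types (U V W : normedModType R).

Lemma iderP V (f f' : unit_itv R -> V) :
  ider f f' <-> forall t,
    (set_val s - set_val t)^-1 *: (f s - f t) @[s --> t^'] --> f' t.
Proof.
split=> [h t|h t].
  have [q [cq qt qE]] := h t.
  have : q s @[s --> t^'] --> f' t.
    by rewrite -qt; apply: cvg_within_filter; exact: cq.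
  apply: cvg_trans; apply: near_eq_cvg.
  near=> s; rewrite qE scalerA mulVf ?scale1r// subr_eq0.
  apply/eqP => /itv_inj st; move: st.
  by apply/eqP; near: s; exact: nbhs_dnbhs_neq.
pose q s := if s == t then f' t else (set_val s - set_val t)^-1 *: (f s - f t).
exists q; split; last 2 first.
- by rewrite /q eqxx.
- move=> s; rewrite /q; case: eqP => [->|st]; first by rewrite !subrr scale0r.
  rewrite scalerA mulfV ?scale1r// subr_eq0.
  by apply/eqP => /itv_inj.
have hq : q s @[s --> t^'] --> q t.
  rewrite {2}/q eqxx; apply: cvg_trans (h t); apply: near_eq_cvg.
  near=> s; rewrite /q ifN//; near: s; exact: nbhs_dnbhs_neq.
move=> P /= qP; have := hq P qP; rewrite /= /dnbhs /within /= !near_simpl => H.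
near=> s; have [->|st] := eqVneq s t; first exact: nbhs_singleton.
by move: st; near: s; exact: H.
Unshelve. all: by end_near. Qed.

Lemma ider_ext V (f f' g' : unit_itv R -> V) : f' =1 g' -> ider f f' -> ider f g'.
Proof. by move=> /funext ->. Qed.

Lemma ider_unique V (f f' g' : unit_itv R -> V) : ider f f' -> ider f g' -> f' = g'.
Proof.
move=> /iderP h1 /iderP h2; apply/funext => t.
have ? := itv_dnbhs_proper t.
exact: (cvg_unique (@norm_hausdorff _ V) (h1 t) (h2 t)).
Qed.

Lemma ider_cst V (v : V) : ider (fun=> v) (fun=> 0).
Proof.
move=> t; exists (fun=> 0); split=> //; first exact: cst_continuous.
by move=> s /=; rewrite subrr scaler0.
Qed.

Lemma iderD V (f f' g g' : unit_itv R -> V) : ider f f' -> ider g g' ->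
  ider (fun t => f t + g t) (fun t => f' t + g' t).
Proof.
move=> h1 h2 t; have [p [cp pt pE]] := h1 t; have [q [cq qt qE]] := h2 t.
exists (fun s => p s + q s); split; first exact: contD_at.
  by rewrite pt qt.
by move=> s; rewrite opprD addrACA pE qE scalerDr.
Qed.

(** One product rule for this notion covers multiplication, scaling, dot and cross products, and
    combinations of frame vectors. *)
Record cont_bilinear U V W (B : U -> V -> W) : Prop := {
  bil_cont : continuous (fun p => B p.1 p.2);
  bil_l : forall v a u u', B (a *: u + u') v = a *: B u v + B u' v;
  bil_r : forall u a v v', B u (a *: v + v') = a *: B u v + B u v' }.

Lemma bilBl U V W (B : U -> V -> W) u u' v : cont_bilinear B ->
  B (u - u') v = B u v - B u' v.
Proof. by move=> hB; rewrite addrC -scaleN1r (bil_l hB) scaleN1r addrC. Qed.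

Lemma bilBr U V W (B : U -> V -> W) u v v' : cont_bilinear B ->
  B u (v - v') = B u v - B u v'.
Proof. by move=> hB; rewrite addrC -scaleN1r (bil_r hB) scaleN1r addrC. Qed.

Lemma bil0l U V W (B : U -> V -> W) v : cont_bilinear B -> B 0 v = 0.
Proof. by move=> hB; rewrite -(subrr 0) bilBl// subrr. Qed.

Lemma bil0r U V W (B : U -> V -> W) u : cont_bilinear B -> B u 0 = 0.
Proof. by move=> hB; rewrite -(subrr 0) bilBr// subrr. Qed.

Lemma bil_comp U V W (B : U -> V -> W) (X : topologicalType) (f : X -> U) (g : X -> V) x :
  cont_bilinear B -> {for x, continuous f} -> {for x, continuous g} ->
  {for x, continuous (fun x => B (f x) (g x))}.
Proof.
move=> hB cf cg.
apply: (@continuous_comp _ _ _ (fun x => (f x, g x)) (fun p => B p.1 p.2)).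
  by rewrite /continuous_at; exact: cvg_pair.
exact: bil_cont.
Qed.

Lemma bil_scale V : cont_bilinear (fun (a : R) (v : V) => a *: v).
Proof.
split; first exact: scale_continuous.
- by move=> v a u u'; rewrite scalerDl scalerA.
- by move=> u a v v'; rewrite scalerDr !scalerA mulrC.
Qed.

Lemma bil_mul : cont_bilinear (fun a b : R => a * b).
Proof. exact: (bil_scale R). Qed.

Lemma ider_cont V (f f' : unit_itv R -> V) : ider f f' -> continuous f.
Proof.
move=> h t; have [q [cq qt qE]] := h t.
have E : (fun s => f t + (set_val s - set_val t) *: q s) = f.
  by apply/funext => s; rewrite -qE addrC subrK.
suff : {for t, continuous (fun s => f t + (set_val s - set_val t) *: q s)} by rewrite E.
apply: contD_at; first exact: cst_continuous.
apply: (bil_comp (bil_scale V)) => //.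
apply: contD_at; last exact: cst_continuous.
exact: continuous_itv_val.
Qed.

Lemma ider_bil U V W (B : U -> V -> W) f f' g g' : cont_bilinear B ->
  ider f f' -> ider g g' ->
  ider (fun t => B (f t) (g t)) (fun t => B (f' t) (g t) + B (f t) (g' t)).
Proof.
move=> hB h1 h2 t; have [p [cp pt pE]] := h1 t; have [q [cq qt qE]] := h2 t.
exists (fun s => B (p s) (g s) + B (f t) (q s)); split.
- apply: contD_at; apply: bil_comp => //; first exact: (ider_cont h2).
  exact: cst_continuous.
- by rewrite pt qt.
move=> s; have -> : B (f s) (g s) - B (f t) (g t) =
    B (f s - f t) (g s) + B (f t) (g s - g t).
  by rewrite bilBl// bilBr// addrA subrK.
rewrite pE qE scalerDr.
by rewrite -[_ *: p s]addr0 (bil_l hB) (bil0l _ hB) addr0 -[_ *: q s]addr0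
  (bil_r hB) (bil0r _ hB) addr0.
Qed.

End Ider.

Lemma continuous_fst (X Y : topologicalType) : continuous (@fst X Y).
Proof. by move=> p; exact: cvg_fst. Qed.

Lemma continuous_snd (X Y : topologicalType) : continuous (@snd X Y).
Proof. by move=> p; exact: cvg_snd. Qed.

(** * Families of curves with jointly continuous derivatives *)

Section Fam.
Variables (R : realType) (T : topologicalType).
Implicit Types (U V W : normedModType R).

(* Since [0, 1] is compact, joint continuity of the first [j] derivatives amounts
   to continuity of the family as a map into the C^j topology. *)
Fixpoint fam V (j : nat) (F : T -> unit_itv R -> V) : Prop :=
  continuous (fun p : T * unit_itv R => F p.1 p.2) /\
  if j is i.+1 then exists F', (forall x, ider (F x) (F' x)) /\ fam i F' else True.

Lemma fam_cont V j (F : T -> unit_itv R -> V) :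
  fam j F -> continuous (fun p : T * unit_itv R => F p.1 p.2).
Proof. by case: j => [|j] []. Qed.

Lemma famW V j (F : T -> unit_itv R -> V) : fam j.+1 F -> fam j F.
Proof.
elim: j F => [|j IH] F [cF [F' [dF hF']]]; split=> //.
by exists F'; split=> //; exact: IH.
Qed.

(** Derivatives are unique, so the one hidden in [fam] is whichever one is at hand. *)
Lemma famS V j (F F' : T -> unit_itv R -> V) :
  fam j.+1 F -> (forall x, ider (F x) (F' x)) -> fam j F'.
Proof.
move=> [_ [G [dG hG]]] dF; suff -> : F' = G by [].
by apply/funext => x; exact: ider_unique (dF x) (dG x).
Qed.

Lemma fam_cst V j (g : T -> V) : continuous g -> fam j (fun x _ => g x).
Proof.
elim: j g => [|j IH] g cg; (split; first by apply: (continuous_after cg); exact: continuous_fst).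
  by [].
exists (fun _ _ => 0); split; first by move=> x; exact: ider_cst.
by apply: IH; exact: cst_continuous.
Qed.

Lemma ider_val : ider (fun t : unit_itv R => set_val t : R) (fun=> 1).
Proof.
move=> t; exists (fun=> 1); split=> //; first exact: cst_continuous.
by move=> s; rewrite /GRing.scale /= mulr1.
Qed.

Lemma fam_val j : fam j (fun _ t => set_val t : R).
Proof.
have cv : continuous (fun p : T * unit_itv R => set_val p.2 : R).
  apply: (continuous_after (@continuous_itv_val R)); exact: continuous_snd.
case: j => [|j]; split=> //; exists (fun _ _ => 1); split.
  by move=> x; exact: ider_val.
by apply: (@fam_cst R j (fun=> 1)); exact: cst_continuous.
Qed.

Lemma famD V j (F G : T -> unit_itv R -> V) :
  fam j F -> fam j G -> fam j (fun x t => F x t + G x t).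
Proof.
elim: j F G => [|j IH] F G hF hG.
  by split=> //; apply: continuousD_fun; exact: (@fam_cont _ 0).
split; first by apply: continuousD_fun; exact: (@fam_cont _ j.+1).
have [_ [F' [dF hF']]] := hF; have [_ [G' [dG hG']]] := hG.
exists (fun x t => F' x t + G' x t); split; last exact: IH.
by move=> x; exact: iderD.
Qed.

Lemma fam_bil U V W (B : U -> V -> W) j (F : T -> unit_itv R -> U)
  (G : T -> unit_itv R -> V) : cont_bilinear B ->
  fam j F -> fam j G -> fam j (fun x t => B (F x t) (G x t)).
Proof.
move=> hB; elim: j F G => [|j IH] F G hF hG.
  by split=> //; move=> p; apply: bil_comp => //; exact: (@fam_cont _ 0).
split; first by move=> p; apply: bil_comp => //; exact: (@fam_cont _ j.+1).
have [_ [F' [dF hF']]] := hF; have [_ [G' [dG hG']]] := hG.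
exists (fun x t => B (F' x t) (G x t) + B (F x t) (G' x t)); split.
  by move=> x; exact: ider_bil.
by apply: famD; apply: IH => //; exact: famW.
Qed.

Lemma famZ V j (k : T -> unit_itv R -> R) (F : T -> unit_itv R -> V) :
  fam j k -> fam j F -> fam j (fun x t => k x t *: F x t).
Proof. exact: fam_bil (bil_scale V). Qed.

Lemma famM j (F G : T -> unit_itv R -> R) :
  fam j F -> fam j G -> fam j (fun x t => F x t * G x t).
Proof. exact: fam_bil (bil_mul R). Qed.

Definition isqrt (a : R) : R := (Num.sqrt a)^-1.

Lemma isqrt_cont (X : topologicalType) (f : X -> R) x :
  0 < f x -> {for x, continuous f} -> {for x, continuous (fun y => isqrt (f y))}.
Proof.
move=> fx cf; apply: (@continuousV R X (fun y => Num.sqrt (f y)) x).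
  by rewrite gt_eqF// sqrtr_gt0.
by apply: (@continuous_comp _ _ _ f (@Num.sqrt R)) => //; exact: sqrt_continuous.
Qed.

(** Rationalization: 1/r - 1/r' = - (r^2 - r'^2) / (r r' (r + r')), where r and r' are the roots of
    f(s) and f(t). Expressing the derivative through [isqrt] itself lets the induction in
    [fam_isqrt] close. *)
Lemma ider_isqrt (f f' : unit_itv R -> R) : (forall t, 0 < f t) -> ider f f' ->
  ider (fun t => isqrt (f t)) (fun t => - 2^-1 * (f' t * (isqrt (f t) ^+ 3))).
Proof.
move=> f0 df; have cf := ider_cont df; move=> t; have [q [cq qt qE]] := df t.
have r0 s : 0 < Num.sqrt (f s) by rewrite sqrtr_gt0.
exists (fun s => - (q s * (isqrt (f s) * isqrt (f t) * (Num.sqrt (f s) + Num.sqrt (f t))^-1))).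
split.
- apply: (@continuousN R R).
  apply: (bil_comp (bil_mul R)) => //; apply: (bil_comp (bil_mul R)).
    apply: (bil_comp (bil_mul R)); last exact: cst_continuous.
    by apply: isqrt_cont; [exact: f0|exact: cf].
  apply: (@continuousV R _ (fun s => Num.sqrt (f s) + Num.sqrt (f t)) t).
    by rewrite gt_eqF// addr_gt0.
  apply: contD_at; last exact: cst_continuous.
  by apply: (@continuous_comp _ _ _ f (@Num.sqrt R)); [exact: cf|exact: sqrt_continuous].
- rewrite qt /isqrt; have := r0 t; move: (Num.sqrt _) => r r_gt0.
  by field; rewrite !gt_eqF ?addr_gt0.
move=> s; rewrite /isqrt scalerN -[_ *: _]/((set_val s - set_val t) * (q s * _)).
have E : (set_val s - set_val t) * q s = Num.sqrt (f s) ^+ 2 - Num.sqrt (f t) ^+ 2.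
  by rewrite !sqr_sqrtr ?ltW// qE.
rewrite mulrA E; have := r0 t; have := r0 s.
move: (Num.sqrt _) (Num.sqrt _) => r r' rp rp'.
by field; rewrite !gt_eqF// addr_gt0.
Qed.

Lemma fam_isqrt j (F : T -> unit_itv R -> R) : (forall x t, 0 < F x t) ->
  fam j F -> fam j (fun x t => isqrt (F x t)).
Proof.
move=> F0; elim: j => [|j IH] hF.
  by split=> // p; apply: isqrt_cont => //; exact: (@fam_cont _ 0).
split; first by move=> p; apply: isqrt_cont => //; exact: (@fam_cont _ j.+1).
have [_ [F' [dF hF']]] := hF.
exists (fun x t => - 2^-1 * (F' x t * (isqrt (F x t) ^+ 3))); split.
  by move=> x; exact: ider_isqrt.
have hi := IH (famW hF).
apply: famM; first by apply: (@fam_cst R j (fun=> - 2^-1)); exact: cst_continuous.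
by apply: famM => //; apply: famM => //; exact: famM.
Qed.

Lemma ider_comp_real (g g' : R -> R) (w : R) :
  (forall x : R, is_derive x 1 g (g' x)) ->
  ider (fun t : unit_itv R => g (w * set_val t)) (fun t => w * g' (w * set_val t)).
Proof.
move=> dg t; have /is_derive1_caratheodory[q [qE cq qt]] := dg (w * set_val t).
exists (fun s => w * q (w * set_val s)); split; last 2 first.
- by rewrite qt.
- by move=> s; rewrite qE /GRing.scale /=; ring.
apply: (bil_comp (bil_mul R)); first exact: cst_continuous.
apply: (@continuous_comp _ _ _ (fun s => w * set_val s) q) => //.
apply: (bil_comp (bil_mul R)); first exact: cst_continuous.
exact: continuous_itv_val.
Qed.

Lemma ider_cosM (w : R) : ider (fun t : unit_itv R => cos (w * set_val t))
  (fun t => w * - sin (w * set_val t)).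
Proof. by apply: (@ider_comp_real cos (fun x => - sin x)) => x; exact: is_derive_cos. Qed.

Lemma ider_sinM (w : R) : ider (fun t : unit_itv R => sin (w * set_val t))
  (fun t => w * cos (w * set_val t)).
Proof. by apply: ider_comp_real => x; exact: is_derive_sin. Qed.

(** Proved jointly because each function is, up to a constant factor, the derivative of the
    other. *)
Lemma fam_cos_sin j (w : R) :
  fam j (fun _ t => cos (w * set_val t)) /\ fam j (fun _ t => sin (w * set_val t)).
Proof.
have fc a i : fam i (fun (_ : T) (_ : unit_itv R) => a : R).
  by apply: (@fam_cst R i (fun=> a)); exact: cst_continuous.
have cw : continuous (fun p : T * unit_itv R => w * set_val p.2).
  apply: continuousM_fun; first exact: cst_continuous.
  apply: (continuous_after (@continuous_itv_val R)); exact: continuous_snd.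
have cc : continuous (fun p : T * unit_itv R => cos (w * set_val p.2)).
  by apply: continuous_after cw; exact: continuous_cos.
have cs : continuous (fun p : T * unit_itv R => sin (w * set_val p.2)).
  by apply: continuous_after cw; exact: continuous_sin.
elim: j => [//|j [hc hs]]; split; split=> //.
  exists (fun _ t => w * - sin (w * set_val t)); split; first by move=> _; exact: ider_cosM.
  apply: famM => //.
  have -> : (fun (_ : T) (t : unit_itv R) => - sin (w * set_val t)) =
            (fun _ t => -1 * sin (w * set_val t)).
    by apply/funext => ?; apply/funext => ?; rewrite mulN1r.
  exact: famM.
exists (fun _ t => w * cos (w * set_val t)); split; first by move=> _; exact: ider_sinM.
exact: famM.
Qed.

End Fam.

(** * Between joint continuity and the C^r topology *)

Lemma near_compactP (X Y : topologicalType) (A : set Y) (P : X -> Y -> Prop) (x : X) :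
  compact A -> (forall y, A y -> \forall p \near (y, x), P p.2 p.1) ->
  \forall x' \near nbhs x, forall y, A y -> P x' y.
Proof.
by move=> /compact_near_coveringP cA h; exact: (cA X (nbhs x) P _ h).
Qed.

(** Tube lemma along the compact interval: a neighbourhood of [x0] that works near each [t] can be
    chosen for all [t] at once. *)
Lemma continuous_uniform (R : realType) (T : topologicalType) (V : normedModType R)
  (F : T -> unit_itv R -> V) :
  continuous (fun p : T * unit_itv R => F p.1 p.2) ->
  continuous (F : T -> {uniform unit_itv R -> V}).
Proof.
move=> cF x0 P /uniform_nbhs[E [entE sEP]].
have : \forall x \near x0, forall t, [set: unit_itv R] t -> E (F x0 t, F x t).
  apply: near_compactP; first exact: compact_itv.
  move=> t _.
  have entE' := entourage_split_ent entE.
  have := cF (x0, t) (xsection ((split_ent E) `&` (split_ent E)^-1%relation) (F x0 t)).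
  case.
    by apply: nbhs_entourage; apply: filterI => //; exact: entourage_inv.
  move=> [A B] /= [hA hB] sAB.
  exists (B, A) => //= -[t' x] /= [Bt' Ax].
  have /= := sAB (x, t') (conj Ax Bt'); rewrite /xsection /= => /set_mem[_ /= h1].
  have /= := sAB (x0, t') (conj (nbhs_singleton hA) Bt').
  rewrite /xsection /= => /set_mem[/= h2 h3].
  have /= := sAB (x, t') (conj Ax Bt'); rewrite /xsection /= => /set_mem[/= h4 _].
  apply: (@entourage_split _ (F x0 t)) => //.
by rewrite /= near_simpl; apply: filterS => x h; apply: sEP => t _; exact: h.
Qed.

Section Bridge.
Variables (R : realType) (r : option nat).
Local Notation V := 'cV[R]_3.

Lemma ider_curve (f f' : unit_itv R -> V) : ider f f' ->
  (forall t, curve_derivable f t) /\ curve_derive f = f'.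
Proof.
move=> /iderP h; split; first by move=> t; apply/cvg_ex; exists (f' t); exact: h.
apply/funext => t; have ? := itv_dnbhs_proper t.
by apply: cvg_lim; [exact: norm_hausdorff|exact: h].
Qed.

Lemma curve_ider (f : unit_itv R -> V) :
  (forall t, curve_derivable f t) -> ider f (curve_derive f).
Proof. by move=> h; apply/iderP => t; exact: h. Qed.

(** Converse direction, by halving epsilon: the derivatives at nearby parameters are close uniformly
    in t, and the one at [x0] is continuous in t. *)
Lemma jet_joint (T : topologicalType) (f : T -> Cr_space R r) m :
  continuous f -> reg_le m r ->
  continuous (fun p : T * unit_itv R => curve_derive_n m (sval (f p.1)) p.2).
Proof.
move=> cf hm.
have cu : continuous (fun x => curve_derive_n m (sval (f x)) : {uniform unit_itv R -> V}).
  move=> x; have cj : continuous (@jet R r) by exact: initial_continuous.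
  apply: (@continuous_comp _ _ _ (fun x => @jet R r (f x)) (fun g => g (exist _ m hm))).
    by apply: continuous_comp; [exact: cf|exact: cj].
  exact: (@proj_continuous _ (fun _ : {j : nat | reg_le j r} => {uniform unit_itv R -> V})).
move=> [x0 t0]; apply/cvgrPdist_lt => e e0 /=.
have e2 : 0 < e / 2 by rewrite divr_gt0.
have [_ /(_ m hm) ct] := set_valP (f x0).
have h1 : \forall x \near x0, forall t,
   `|curve_derive_n m (sval (f x0)) t - curve_derive_n m (sval (f x)) t| < e / 2.
  apply: (cu x0 [set g | forall t, `|curve_derive_n m (sval (f x0)) t - g t| < e / 2]).
  apply/uniform_nbhs.
  exists [set p | `|p.1 - p.2| < e / 2]; split; last by move=> g h y; exact: h.
  by rewrite -entourage_ballE /=; exists (e / 2) => //= -[a b] /=; rewrite -ball_normE.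
have h2 : \forall t \near t0,
   `|curve_derive_n m (sval (f x0)) t0 - curve_derive_n m (sval (f x0)) t| < e / 2.
  by have /cvgrPdist_lt := ct t0; apply.
near=> p; rewrite -(subrK (curve_derive_n m (sval (f x0)) p.2) (curve_derive_n m _ t0)) -addrA.
apply: (le_lt_trans (ler_normD _ _)); rewrite (splitr e); apply: ltrD.
- by near: p; exists ([set: T], [set t |
    `|curve_derive_n m (sval (f x0)) t0 - curve_derive_n m (sval (f x0)) t| < e / 2])
    => /= [|[] ? ? /= []//]; split => //; exact: filterT.
- near: p; exists ([set x | forall t,
    `|curve_derive_n m (sval (f x0)) t - curve_derive_n m (sval (f x)) t| < e / 2],
    [set: unit_itv R]) => /= [|[] ? ? /= []//]; split => //; exact: filterT.
Unshelve. all: by end_near. Qed.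

(** The offset [m] carries the induction: differentiating trades one unit of [j] for one of [m],
    with the sum fixed. *)
Lemma fam_of_Cr (T : topologicalType) (f : T -> Cr_space R r) :
  continuous f -> forall j m, reg_le (m + j) r ->
  fam j (fun x => curve_derive_n m (sval (f x))).
Proof.
move=> cf; elim=> [|j IH] m hm.
  by split=> //; apply: jet_joint => //; move: hm; rewrite addn0.
have hle i k : (i <= k)%N -> reg_le k r -> reg_le i r.
  by case: r => //= n; exact: leq_trans.
split; first by apply: jet_joint => //; apply: hle hm; exact: leq_addr.
exists (fun x => curve_derive_n m.+1 (sval (f x))); split; last first.
  by apply: IH; rewrite addSnnS.
move=> x; apply: curve_ider; have [h _] := set_valP (f x).
by apply: h; apply: hle hm; rewrite addnS ltnS leq_addr.
Qed.

Lemma fam_curve_derive_n (T : topologicalType) (F : T -> unit_itv R -> V) i k :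
  fam (i + k) F -> fam k (fun x => curve_derive_n i (F x)).
Proof.
elim: i k => [//|i IH] k; rewrite addSnnS => /IH hF.
have [_ [G [dG hG]]] := hF.
suff -> : (fun x => curve_derive_n i.+1 (F x)) = G by [].
by apply/funext => x; have [_] := ider_curve (dG x).
Qed.

Lemma Cr_of_fam (T : topologicalType) (F : T -> unit_itv R -> V) :
  (forall j, reg_le j r -> fam j F) -> forall x, Cr r (F x).
Proof.
move=> hF x; split=> j hj.
  have [_ [G [dG _]]] : fam 1 (fun x => curve_derive_n j (F x)).
    by apply: fam_curve_derive_n; rewrite addn1; exact: hF.
  by have [] := ider_curve (dG x).
have [cG _] : fam 0 (fun x => curve_derive_n j (F x)).
  by apply: fam_curve_derive_n; rewrite addn0; exact: hF.
apply: (continuous_after cG (g := fun t => (x, t))).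
by apply: continuous_pair; [exact: cst_continuous|by move=> ?; exact: cvg_id].
Qed.

(** The topology is initial for [jet], and a product topology is a supremum of initial ones, so
    continuity is tested on one derivative at a time, by [continuous_uniform]. *)
Lemma continuous_Cr (T : topologicalType) (f : T -> Cr_space R r) :
  (forall j, reg_le j r -> fam j (fun x => sval (f x))) -> continuous f.
Proof.
move=> hF; apply: continuous_comp_initial => x; apply/cvg_sup => -[j hj].
have : continuous (fun x => @jet R r (f x) : initial_topology (fun g : prod_topology
      (fun _ : {j : nat | reg_le j r} => {uniform unit_itv R -> 'cV[R]_3}) => g (exist _ j hj))).
  apply: continuous_comp_initial.
  apply: (@continuous_uniform _ _ _ (fun x => curve_derive_n j (sval (f x)))).
  suff [] : fam 0 (fun x => curve_derive_n j (sval (f x))) by [].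
  by apply: fam_curve_derive_n; rewrite addn0; exact: hF.
exact.
Qed.

End Bridge.

(** Near a zero of [E], [G] stays positive and any w >= 0 will do; near any other point [E] is
    bounded below and a large w beats [G]. Compactness makes the bound on w uniform. *)
Lemma pos_large (R : realType) (X : topologicalType) (A : set X) (E G : X -> R) :
  compact A -> continuous E -> continuous G ->
  (forall x, A x -> 0 <= E x) -> (forall x, A x -> E x = 0 -> 0 < G x) ->
  \forall w \near +oo, forall x, A x -> 0 < w * E x + G x.
Proof.
move=> /compact_near_coveringP cA cE cG E0 EG.
have := cA R (@pinfty_nbhs R) (fun w x => A x -> 0 < w * E x + G x) _.
suff H : forall x, A x -> \forall x' \near x & w \near +oo, A x' -> 0 < w * E x' + G x'.
  by move=> /(_ _ H); apply: filterS => w h x Ax; exact: h.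
move=> x Ax; have := E0 _ Ax; rewrite le_eqVlt => /predU1P[/esym E_0|E_gt0].
  have G0 := EG _ Ax E_0.
  near=> x' w => /= Ax'.
  apply: ltr_wpDl.
    by apply: mulr_ge0; [near: w; apply: nbhs_pinfty_ge; exact: num_real|exact: E0].
  by near: x'; exact: (cG x (fun y => 0 < y)) (lt_nbhsr G0).
near=> x' w => /= Ax'.
have h1 : E x / 2 < E x'.
  near: x'; apply: (cE x (fun y => E x / 2 < y)); apply: lt_nbhsr.
  by rewrite ltr_pdivrMr// ltr_pMr// ltr1n.
have h2 : - (`|G x| + 1) < G x'.
  near: x'; apply: (cG x (fun y => - (`|G x| + 1) < y)); apply: lt_nbhsr.
  by have := ler_norm (- G x); rewrite normrN; lra.
have h3 : (`|G x| + 1) / (E x / 2) <= w by near: w; apply: nbhs_pinfty_ge; exact: num_real.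
have h4 : `|G x| + 1 <= w * (E x / 2) by rewrite -ler_pdivrMr// divr_gt0.
have w0 : 0 <= w by apply: le_trans h3; rewrite divr_ge0// ?divr_ge0// ?addr_ge0// ltW.
by have := ler_wpM2l w0 (ltW h1); lra.
Unshelve. all: by end_near. Qed.

Lemma pos_small (R : realType) (X : topologicalType) (A : set X) (D : R * X -> R) :
  compact A -> continuous D -> (forall x, A x -> 0 < D (0, x)) ->
  \forall e \near (0 : R), forall x, A x -> 0 < D (e, x).
Proof.
move=> cA cD D0; apply: (@near_compactP R X A (fun e y => 0 < D (e, y)) 0 cA) => y Ay.
have cs : continuous (fun p : X * R => D (p.2, p.1)).
  by apply: continuous_after cD _; apply: continuous_pair;
    [exact: continuous_snd|exact: continuous_fst].
by have := cs (y, 0) (fun z => 0 < z); apply; exact: lt_nbhsr (D0 _ Ay).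
Qed.

(** * Bernstein polynomials with vector values *)

Section Bernstein.
Variable (R : realType).

(* With [f i] the value at the node [i / n], this is the Bernstein polynomial of
   degree [n]; the recursion conditions the binomial law on its first trial. *)
Fixpoint bern (V : lmodType R) (n : nat) (f : nat -> V) (t : R) : V :=
  if n is m.+1 then (1 - t) *: bern m f t + t *: bern m (f \o S) t else f 0%N.

Lemma bern_at0 (V : lmodType R) n (f : nat -> V) : bern n f 0 = f 0%N.
Proof. by elim: n => [//|n IH] /=; rewrite IH subr0 scale1r scale0r addr0. Qed.

Lemma bern_at1 (V : lmodType R) n (f : nat -> V) : bern n f 1 = f n.
Proof. by elim: n f => [//|n IH] f /=; rewrite !IH subrr scale1r scale0r add0r. Qed.

Lemma bern_bil (U V W : normedModType R) (B : U -> V -> W) n u (f : nat -> V) t :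
  cont_bilinear B -> B u (bern n f t) = bern n (fun i => B u (f i)) t.
Proof.
move=> hB; elim: n f => [//|n IH] f /=.
by rewrite (bil_r hB) -[t *: _]addr0 (bil_r hB) (bil0r _ hB) addr0 !IH.
Qed.

Lemma bernD (V : lmodType R) n (f g : nat -> V) t :
  bern n (fun i => f i + g i) t = bern n f t + bern n g t.
Proof.
elim: n f g => [//|n IH] f g /=; rewrite /comp !IH !scalerDr.
by rewrite addrACA.
Qed.

Lemma bern_le n (f g : nat -> R) t : 0 <= t <= 1 -> (forall i, f i <= g i) ->
  bern n f t <= bern n g t.
Proof.
move=> /andP[t0 t1]; elim: n f g => [|n IH] f g fg /=; first exact: fg.
by apply: (@lerD R); apply: (@ler_wpM2l R); rewrite ?subr_ge0//; apply: IH => i //=.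
Qed.

Lemma bern_cst (V : lmodType R) n (v : V) t : bern n (fun=> v) t = v.
Proof. by elim: n => [//|n IH] /=; rewrite /comp IH -scalerDl subrK scale1r. Qed.

(** Second moment of a shifted binomial variable: squared mean plus variance n t (1 - t). The shift
    is general because conditioning on the first trial replaces [a] by 1 + a; with a = - n t only
    the variance remains. *)
Lemma bern_sqr n (a t : R) :
  bern n (fun i => (i%:R + a) ^+ 2) t = (n%:R * t + a) ^+ 2 + n%:R * (t * (1 - t)).
Proof.
elim: n a => [|n IH] a /=; first by rewrite !mul0r !add0r addr0.
have -> : (fun i => (i%:R + a) ^+ 2 : R) \o S = (fun i => (i%:R + (1 + a)) ^+ 2).
  by apply/funext => i /=; rewrite -natr1 addrA.
by rewrite !IH -[n.+1]addn1 natrD /GRing.scale /=; ring.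
Qed.

(** The dependence on t is polynomial, so mere continuity of the node values in x gives every order
    of differentiability: this is how b escapes the loss of a derivative. *)
Lemma fam_bern (T : topologicalType) (V : normedModType R) j n (g : nat -> T -> V) :
  (forall i, continuous (g i)) ->
  fam j (fun x (t : unit_itv R) => bern n (fun i => g i x) (set_val t)).
Proof.
elim: n g => [|n IH] g cg /=; first exact: fam_cst.
apply: famD; apply: famZ.
- apply: famD; first by apply: (@fam_cst R T R j (fun=> 1)); exact: cst_continuous.
  have -> : (fun (_ : T) (t : unit_itv R) => - set_val t : R) = (fun _ t => -1 * set_val t).
    by apply/funext => ?; apply/funext => ?; rewrite mulN1r.
  apply: famM; last exact: fam_val.
  by apply: (@fam_cst R T R j (fun=> -1)); exact: cst_continuous.
- exact: IH.
- exact: fam_val.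
- by apply: (IH (fun i => g i.+1)) => i.
Qed.

End Bernstein.

(** * Vector algebra and determinants in dimension three *)

Section Vectors.
Variable R : realType.
Local Notation V := 'cV[R]_3.
Implicit Types (u v w : V) (a b c : R).

Lemma sum3 (M : nmodType) (F : 'I_3 -> M) : \sum_(i < 3) F i = F 0 + F 1 + F 2%:R.
Proof.
rewrite !big_ord_recr big_ord0 /= add0r.
by congr (F _ + F _ + F _); apply: val_inj.
Qed.

Definition vec3 a b c : V :=
  a *: delta_mx 0 0 + b *: delta_mx 1 0 + c *: delta_mx 2%:R 0.

Lemma vec3_0 a b c : vec3 a b c 0 0 = a.
Proof. by rewrite !mxE /= mulr1 !mulr0 !addr0. Qed.

Lemma vec3_1 a b c : vec3 a b c 1 0 = b.
Proof. by rewrite !mxE /= mulr1 !mulr0 add0r addr0. Qed.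

Lemma vec3_2 a b c : vec3 a b c 2%:R 0 = c.
Proof. by rewrite !mxE /= mulr1 !mulr0 !add0r. Qed.

Definition vec3E := (vec3_0, vec3_1, vec3_2).

Lemma vec3P u v : u 0 0 = v 0 0 -> u 1 0 = v 1 0 -> u 2%:R 0 = v 2%:R 0 -> u = v.
Proof.
move=> h0 h1 h2; apply/matrixP => i j; rewrite (ord1 j).
have [->|->|->] // : [\/ i = 0, i = 1 | i = 2%:R].
by case: i => [[|[|[|//]]]] hi; [constructor 1|constructor 2|constructor 3]; exact: val_inj.
Qed.

Lemma continuous_vec3 (X : topologicalType) (f g h : X -> R) :
  continuous f -> continuous g -> continuous h ->
  continuous (fun x => vec3 (f x) (g x) (h x)).
Proof.
move=> cf cg ch.
by do 2?[apply: continuousD_fun]; apply: continuousZ_fun => //; exact: cst_continuous.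
Qed.

Lemma continuous_coord (X : topologicalType) (f : X -> V) i :
  continuous f -> continuous (fun x => f x i 0).
Proof.
move=> cf; apply: (continuous_after (f := fun M : V => M i 0)) cf.
exact: coord_continuous.
Qed.

Definition dot u v : R := u 0 0 * v 0 0 + u 1 0 * v 1 0 + u 2%:R 0 * v 2%:R 0.

Definition cross u v : V :=
  vec3 (u 1 0 * v 2%:R 0 - u 2%:R 0 * v 1 0) (u 2%:R 0 * v 0 0 - u 0 0 * v 2%:R 0)
       (u 0 0 * v 1 0 - u 1 0 * v 0 0).

Definition trip u v w : R := dot u (cross v w).

Lemma continuous_dot (X : topologicalType) (f g : X -> V) :
  continuous f -> continuous g -> continuous (fun x => dot (f x) (g x)).
Proof.
move=> cf cg; do 2?[apply: continuousD_fun];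
  by apply: continuousM_fun; apply: continuous_coord.
Qed.

Lemma continuous_cross (X : topologicalType) (f g : X -> V) :
  continuous f -> continuous g -> continuous (fun x => cross (f x) (g x)).
Proof.
move=> cf cg; apply: continuous_vec3 => x; apply: cvgB; move: x;
  by apply: continuousM_fun; apply: continuous_coord.
Qed.

Lemma continuous_trip (X : topologicalType) (f g h : X -> V) :
  continuous f -> continuous g -> continuous h ->
  continuous (fun x => trip (f x) (g x) (h x)).
Proof. by move=> cf cg ch; apply: continuous_dot => //; exact: continuous_cross. Qed.

Lemma bil_dot : cont_bilinear dot.
Proof.
split.
- by apply: continuous_dot; [exact: continuous_fst|exact: continuous_snd].
- by move=> v a u u'; rewrite /dot !mxE /GRing.scale /=; ring.
- by move=> v a u u'; rewrite /dot !mxE /GRing.scale /=; ring.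
Qed.

Lemma bil_cross : cont_bilinear cross.
Proof.
split.
- by apply: continuous_cross; [exact: continuous_fst|exact: continuous_snd].
- by move=> v a u u'; apply: vec3P; rewrite /cross !(vec3E, mxE) -/(cross _ _) ?vec3E; ring.
- by move=> v a u u'; apply: vec3P; rewrite /cross !(vec3E, mxE) -/(cross _ _) ?vec3E; ring.
Qed.

Lemma dot_ge0 u : 0 <= dot u u.
Proof. by rewrite /dot !addr_ge0// -expr2 sqr_ge0. Qed.

Lemma dot_gt0 u : u <> 0 -> 0 < dot u u.
Proof.
move=> u0; rewrite lt_neqAle dot_ge0 andbT eq_sym; apply/eqP => d0; apply: u0.
move: d0; rewrite /dot -!expr2 => /eqP.
rewrite paddr_eq0 ?addr_ge0 ?sqr_ge0// => /andP[].
rewrite paddr_eq0 ?sqr_ge0// !sqrf_eq0 => /andP[/eqP h0 /eqP h1] /eqP h2.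
by apply: vec3P; rewrite ?h0 ?h1 ?h2 mxE.
Qed.

Lemma det3 (M : 'M[R]_3) : \det M =
  trip (col 0 M) (col 1 M) (col 2%:R M).
Proof.
rewrite /trip /dot /cross !vec3E !mxE.
rewrite (expand_det_col _ 0) sum3 /cofactor.
rewrite !(expand_det_row _ 0) !big_ord_recl !big_ord0 /cofactor !det_mx11 !mxE /=.
pose m i j := M (inord i) (inord j).
have mE (i j : 'I_3) : M i j = m i j by rewrite /m !inord_val.
by rewrite !mE /= /bump /=; ring.
Qed.

Lemma det_trip u v w : \det (row_mx u (row_mx v w) : 'M[R]_3) = trip u v w.
Proof.
rewrite det3; congr (trip _ _ _); apply/colP => i; rewrite mxE.
- rewrite (_ : 0 = lshift 2 0 :> 'I_(1 + 2)); last exact: val_inj.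
  by rewrite (@row_mxEl _ 3 1 2).
- rewrite (_ : 1 = rshift 1 (lshift 1 0) :> 'I_(1 + (1 + 1))); last exact: val_inj.
  by rewrite (@row_mxEr _ 3 1 (1 + 1)) (@row_mxEl _ 3 1 1).
- rewrite (_ : 2%:R = rshift 1 (rshift 1 0) :> 'I_(1 + (1 + 1))); last exact: val_inj.
  by rewrite (@row_mxEr _ 3 1 (1 + 1)) (@row_mxEr _ 3 1 1).
Qed.

(** Multiplicativity of the determinant, for a frame matrix times a coordinate matrix. *)
Lemma trip_mix u1 u2 u3 a1 a2 a3 b1 b2 b3 c1 c2 c3 :
  trip (a1 *: u1 + a2 *: u2 + a3 *: u3) (b1 *: u1 + b2 *: u2 + b3 *: u3)
       (c1 *: u1 + c2 *: u2 + c3 *: u3) =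
  trip u1 u2 u3 * trip (vec3 a1 a2 a3) (vec3 b1 b2 b3) (vec3 c1 c2 c3).
Proof. by rewrite /trip /dot /cross !vec3E !mxE; ring. Qed.

Lemma tripD u v v' w a : trip u (a *: v + v') w = a * trip u v w + trip u v' w.
Proof. by rewrite /trip /dot /cross !vec3E !mxE; ring. Qed.

End Vectors.

(** * The satellite ground track *)

Section Track.
Variable R : realType.
Implicit Types (C S h c d : R).

(* Ground track, at time (c, d) = (cos u, sin u), of a satellite on an orbit of
   inclination i, where (C, S) = (cos i, sin i), i.e. the orbit (c, d, 0) turned by
   the angle -u about (S, 0, C); it is then lifted by h (0, 0, 1 - cos 2u). The
   primed versions are its derivatives in u. *)
Definition trk C S h c d : 'cV[R]_3 := vec3
  (C + (1 - C) * c ^+ 2 + (1 - C ^+ 2) * (c - c ^+ 2))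
  ((1 - C) * (c * d))
  (S * (C * c - 1 + (1 - C) * c ^+ 2) + 2 * h * (1 - c ^+ 2)).

Definition trk' C S h c d : 'cV[R]_3 := vec3
  ((1 - C ^+ 2) * (2 * (c * d) - d) - 2 * (1 - C) * (c * d))
  ((1 - C) * (c ^+ 2 - d ^+ 2))
  (S * (- (C * d) - 2 * (1 - C) * (c * d)) + 4 * h * (c * d)).

Definition trk'' C S h c d : 'cV[R]_3 := vec3
  ((1 - C ^+ 2) * (2 * (c ^+ 2 - d ^+ 2) - c) - 2 * (1 - C) * (c ^+ 2 - d ^+ 2))
  ((1 - C) * (- 4 * (c * d)))
  (S * (- (C * c) - 2 * (1 - C) * (c ^+ 2 - d ^+ 2)) + 4 * h * (c ^+ 2 - d ^+ 2)).

(* The normal e3 of the orbit, turned by the same angle -u about (S, 0, C). *)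
Definition pole C S c d : 'cV[R]_3 := vec3
  ((1 - c) * (C * S)) (S * d) (c + (1 - c) * C ^+ 2).

(** Put p = (c, d, 0) and n = (S, 0, C). Undoing the rotation by -u turns the three vectors into p,
    p' - n x p and e3, and det(p, p', e3) = 1 while det(p, n x p, e3) = C. *)
Lemma trip_pole0 C S c d : c ^+ 2 + d ^+ 2 = 1 -> C ^+ 2 + S ^+ 2 = 1 ->
  trip (trk C S 0 c d) (trk' C S 0 c d) (pole C S c d) = 1 - C.
Proof.
move=> h1 h2; have hd : d ^+ 2 = 1 - c ^+ 2 by rewrite -h1; ring.
have hS : S ^+ 2 = 1 - C ^+ 2 by rewrite -h2; ring.
rewrite /trip /dot /cross /trk /trk' /pole !vec3E.
ring: hd hS.
Qed.

(** The pole is now e3, so only the horizontal projection (cos 2u, sin 2u) matters and the lift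
    drops out. *)
Lemma trip_pole1 h c d : c ^+ 2 + d ^+ 2 = 1 ->
  trip (trk (-1) 0 h c d) (trk' (-1) 0 h c d) (pole (-1) 0 c d) = 2.
Proof.
move=> h1; have hd : d ^+ 2 = 1 - c ^+ 2 by rewrite -h1; ring.
rewrite /trip /dot /cross /trk /trk' /pole !vec3E.
ring: hd.
Qed.

(** The track is (cos 2u, sin 2u, h (1 - cos 2u)), an ellipse in the plane z = h (1 - x), which
    misses the origin as soon as h is nonzero. *)
Lemma trip_convex h c d : c ^+ 2 + d ^+ 2 = 1 ->
  trip (trk (-1) 0 h c d) (trk' (-1) 0 h c d) (trk'' (-1) 0 h c d) = 8 * h.
Proof.
move=> h1; have hd : d ^+ 2 = 1 - c ^+ 2 by rewrite -h1; ring.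
rewrite /trip /dot /cross /trk /trk' /trk'' !vec3E.
ring: hd.
Qed.
End Track.

(* By compactness 1 <= w2 (w1 (s - t)^2 + v(s) . v(t)) for suitable constants, and the
   Bernstein operator in s maps (s - t)^2 to t (1 - t) / n. *)
Lemma smooth_direction (R : realType) (T : topologicalType) (v : T -> unit_itv R -> 'cV[R]_3) :
  compact [set: T] -> continuous (fun p : T * unit_itv R => v p.1 p.2) ->
  (forall x t, v x t <> 0) ->
  exists b : T -> unit_itv R -> 'cV[R]_3,
    [/\ forall j, fam j b, forall x t, 0 < dot (v x t) (b x t),
        forall x, b x (I0 R) = v x (I0 R) & forall x, b x (I1 R) = v x (I1 R)].
Proof.
move=> cT cv v0; pose X := (T * unit_itv R * unit_itv R)%type.
have cX : compact [set: X].
  by rewrite -setXTT; apply: compact_setX; [rewrite -setXTT; apply: compact_setX => //|];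
    exact: compact_itv.
pose E (p : X) := (set_val p.1.2 - set_val p.2 : R) ^+ 2.
pose G (p : X) := dot (v p.1.1 p.2) (v p.1.1 p.1.2).
have c1 : continuous (fun p : X => p.1) by exact: continuous_fst.
have c11 : continuous (fun p : X => p.1.1) by apply: continuous_after c1; exact: continuous_fst.
have c12 : continuous (fun p : X => p.1.2) by apply: continuous_after c1; exact: continuous_snd.
have c2 : continuous (fun p : X => p.2) by exact: continuous_snd.
have cE : continuous E.
  have cd : continuous (fun p : X => set_val p.1.2 - set_val p.2 : R).
    by move=> p; apply: cvgB;
     [apply: (continuous_after (@continuous_itv_val R) c12)
     |apply: (continuous_after (@continuous_itv_val R) c2)].
  exact: continuousM_fun.
have cG : continuous G.
  apply: continuous_dot.
    by apply: (continuous_after cv (g := fun p : X => (p.1.1, p.2))); exact: continuous_pair.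
  by apply: (continuous_after cv (g := fun p : X => (p.1.1, p.1.2))); exact: continuous_pair.
have E0 p : [set: X] p -> 0 <= E p by move=> _; exact: sqr_ge0.
(* [E] vanishes only on the diagonal s = t, where [G] is the squared length of v. *)
have EG p : [set: X] p -> E p = 0 -> 0 < G p.
  move=> _ /eqP; rewrite sqrf_eq0 subr_eq0 => /eqP/itv_inj st.
  by rewrite /G st; apply: dot_gt0.
have [w1 /= [h1 w1_gt0]] := filter_ex (filterI (pos_large cX cE cG E0 EG)
  (nbhs_pinfty_gt (num_real (0 : R)))).
have cE2 : continuous (fun p => w1 * E p + G p).
  by apply: continuousD_fun => //; apply: continuousM_fun => //; exact: cst_continuous.
have E20 p : [set: X] p -> 0 <= w1 * E p + G p by move=> /h1 /ltW.
(* Vacuous, since [h1] makes the function positive; this second use of [pos_large], against the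
   constant -1, scales it above 1. *)
have EG2 p : [set: X] p -> w1 * E p + G p = 0 -> 0 < -1 :> R.
  by move=> Xp h; have h' : 0 < w1 * E p + G p := h1 p Xp; rewrite h ltxx in h'.
have [w2 /= [h2 w2_gt0]] := filter_ex (filterI
  (pos_large cX cE2 (@cst_continuous _ _ (-1 : R)) E20 EG2) (nbhs_pinfty_gt (num_real (0 : R)))).
(* With n > w2 w1 the variance term w2 w1 t (1 - t) / n stays below 1, leaving w2 (v . b) > 0. *)
pose n := (Num.truncn (w2 * w1)).+1.
have hn : w2 * w1 < n%:R by apply: truncnS_gt.
have n0 : 0 < n%:R :> R by rewrite ltr0n.
(* [bern_le] compares values at every natural i; beyond n the clamped node is no farther from t than
   i / n, by [clamp_dist]. *)
pose node i : unit_itv R := clamp (i%:R / n%:R).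
exists (fun x t => bern n (fun i => v x (node i)) (set_val t)); split.
- move=> j; apply: fam_bern => i.
  apply: (continuous_after cv (g := fun x => (x, node i))).
  by apply: continuous_pair; [move=> ?; exact: cvg_id|exact: cst_continuous].
- move=> x t; rewrite (bern_bil _ _ _ _ (bil_dot R)).
  have t0 := itv_ge0 t; have t1 := itv_le1 t.
  set d := bern _ _ _.
  suff : 1 <= w2 * w1 * (set_val t * (1 - set_val t) / n%:R) + w2 * d.
    have : w2 * w1 * (set_val t * (1 - set_val t) / n%:R) < 1.
      rewrite mulrA ltr_pdivrMr// mul1r; apply: le_lt_trans hn.
      by rewrite ler_piMr ?mulr_ge0 ?ltW//; nra.
    move=> ha hb; have : 0 < w2 * d by lra.
    by rewrite pmulr_rgt0.
  have <- : bern n (fun i => (i%:R / n%:R - set_val t) ^+ 2) (set_val t) =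
      set_val t * (1 - set_val t) / n%:R.
    have -> : (fun i => (i%:R / n%:R - set_val t) ^+ 2 : R) =
       (fun i => n%:R ^- 2 * (i%:R + - (n%:R * set_val t)) ^+ 2).
      by apply/funext => i; field; rewrite gt_eqF.
    rewrite -(bern_bil _ _ _ _ (bil_mul R)) bern_sqr.
    by field; rewrite gt_eqF.
  rewrite /d (bern_bil _ _ _ _ (bil_mul R)) (bern_bil _ (w2 * w1) _ _ (bil_mul R)) -bernD.
  rewrite -[leLHS](bern_cst n (1 : R) (set_val t)); apply: bern_le; first by rewrite t0 t1.
  move=> i; have := h2 (x, node i, t) I; rewrite /E /G /= => h.
  have hc := clamp_dist (i%:R / n%:R) t.
  have hc2 := ler_wpM2l (ltW (mulr_gt0 w2_gt0 w1_gt0)) hc.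
  rewrite -/(node i) in hc2.
  by move: h hc2; rewrite subr_gt0 mulrDr mulrA; lra.
- by move=> x; rewrite bern_at0 /node mul0r; congr (v x _); rewrite -[I0 R]clampK.
- move=> x; rewrite bern_at1 /node divff ?gt_eqF//; congr (v x _); rewrite -[I1 R]clampK.
  by [].
Qed.

(** * The track in a moving frame *)

Section Quad.
Variable R : realType.
Local Notation V := 'cV[R]_3.

(** Quadratic polynomials in (cos, sin): a class stable under differentiation that contains [trk]
    and its derivatives, so that the calculus of the track is a matching of coefficients. *)
Definition quad (k0 k1 k2 k3 k4 k5 : V) (c d : R) : V :=
  k0 + c *: k1 + d *: k2 + (c * c) *: k3 + (c * d) *: k4 + (d * d) *: k5.

Lemma ider_quad (w : R) k0 k1 k2 k3 k4 k5 :
  ider (fun t : unit_itv R => quad k0 k1 k2 k3 k4 k5 (cos (w * set_val t)) (sin (w * set_val t)))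
       (fun t => w *: quad 0 k2 (- k1) k4 (2 *: (k5 - k3)) (- k4)
                      (cos (w * set_val t)) (sin (w * set_val t))).
Proof.
have hc := @ider_cosM R w; have hs := @ider_sinM R w.
have kc v := @ider_cst R V v.
pose B := ider_bil (bil_scale V); pose M := ider_bil (bil_mul R).
have H := iderD (iderD (iderD (iderD (iderD (kc k0) (B _ _ _ _ hc (kc k1)))
  (B _ _ _ _ hs (kc k2))) (B _ _ _ _ (M _ _ _ _ hc hc) (kc k3)))
  (B _ _ _ _ (M _ _ _ _ hc hs) (kc k4))) (B _ _ _ _ (M _ _ _ _ hs hs) (kc k5)).
apply: ider_ext H => t /=; rewrite /quad.
by apply: vec3P; rewrite !mxE; ring.
Qed.

Lemma fam_quad (T : topologicalType) j (w : R) (k0 k1 k2 k3 k4 k5 : T -> V) :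
  continuous k0 -> continuous k1 -> continuous k2 ->
  continuous k3 -> continuous k4 -> continuous k5 ->
  fam j (fun x t => quad (k0 x) (k1 x) (k2 x) (k3 x) (k4 x) (k5 x)
                         (cos (w * set_val t)) (sin (w * set_val t))).
Proof.
move=> c0 c1 c2 c3 c4 c5; have [hc hs] := @fam_cos_sin R T j w.
have F k : continuous k -> fam j (fun x (_ : unit_itv R) => k x : V) by exact: fam_cst.
by repeat (apply: famD; last by apply: famZ; [try exact: famM|exact: F]); exact: F.
Qed.

Definition mix (a : V) (u : 'I_3 -> V) : V :=
  a 0 0 *: u 0 + a 1 0 *: u 1 + a 2%:R 0 *: u 2%:R.

Lemma bil_coordZ i : cont_bilinear (fun a u : V => a i 0 *: u).
Proof.
split.
- apply: continuousZ_fun; last exact: continuous_snd.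
  by apply: continuous_coord; exact: continuous_fst.
- by move=> v a u u'; rewrite !mxE scalerDl scalerA.
- by move=> u a v v'; rewrite scalerDr !scalerA mulrC.
Qed.

Lemma ider_mix (a a' : unit_itv R -> V) (u u' : 'I_3 -> unit_itv R -> V) :
  ider a a' -> (forall i, ider (u i) (u' i)) ->
  ider (fun t => mix (a t) (u^~ t)) (fun t => mix (a' t) (u^~ t) + mix (a t) (u'^~ t)).
Proof.
move=> ha hu; have B i := ider_bil (bil_coordZ i) ha (hu i).
apply: ider_ext (iderD (iderD (B 0) (B 1)) (B 2%:R)) => t /=.
by rewrite /mix [RHS]addrACA; congr (_ + _); rewrite [RHS]addrACA.
Qed.

Lemma fam_mix (T : topologicalType) j (a : T -> unit_itv R -> V)
  (u : 'I_3 -> T -> unit_itv R -> V) :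
  fam j a -> (forall i, fam j (u i)) -> fam j (fun x t => mix (a x t) (fun i => u i x t)).
Proof.
move=> ha hu; have B i := fam_bil (bil_coordZ i) ha (hu i).
by apply: famD => //; exact: famD.
Qed.

Lemma continuous_mix (X : topologicalType) (a : X -> V) (u : 'I_3 -> X -> V) :
  continuous a -> (forall i, continuous (u i)) ->
  continuous (fun x => mix (a x) (fun i => u i x)).
Proof.
move=> ca cu; do 2?[apply: continuousD_fun]; apply: continuousZ_fun => //;
  exact: continuous_coord.
Qed.

Lemma trip_mix_mix a b c u : trip (mix a u) (mix b u) (mix c u) =
  trip (u 0) (u 1) (u 2%:R) * trip a b c.
Proof. by rewrite /mix trip_mix; congr (_ * trip _ _ _); apply: vec3P; rewrite vec3E. Qed.

Lemma mix_e1 u : mix (vec3 1 0 0) u = u 0.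
Proof. by rewrite /mix !vec3E !scale0r scale1r !addr0. Qed.

Lemma mix_e2 a u : mix (vec3 0 a 0) u = a *: u 1.
Proof. by rewrite /mix !vec3E !scale0r add0r addr0. Qed.

Lemma mix_e3 u : mix (vec3 0 0 1) u = u 2%:R.
Proof. by rewrite /mix !vec3E !scale0r scale1r !add0r. Qed.

Lemma mixZ a k u : mix (k *: a) u = k *: mix a u.
Proof. by rewrite /mix !mxE -!scalerA -!scalerDr. Qed.

Lemma ider_trk C S h w : ider
  (fun t : unit_itv R => trk C S h (cos (w * set_val t)) (sin (w * set_val t)))
  (fun t => w *: trk' C S h (cos (w * set_val t)) (sin (w * set_val t))).
Proof.
have := @ider_quad w (vec3 C 0 (2 * h - S)) (vec3 (1 - C ^+ 2) 0 (S * C)) 0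
  (vec3 ((1 - C) - (1 - C ^+ 2)) 0 (S * (1 - C) - 2 * h)) (vec3 0 (1 - C) 0) 0.
have -> : quad (vec3 C 0 (2 * h - S)) (vec3 (1 - C ^+ 2) 0 (S * C)) 0
  (vec3 ((1 - C) - (1 - C ^+ 2)) 0 (S * (1 - C) - 2 * h)) (vec3 0 (1 - C) 0) 0 = trk C S h.
  apply/funext => c; apply/funext => d; rewrite /quad /trk.
  by apply: vec3P; rewrite !(vec3E, mxE) /= ; ring.
apply: ider_ext => t; congr (_ *: _); rewrite /quad /trk'.
by apply: vec3P; rewrite !(vec3E, mxE) /=; ring.
Qed.

Lemma ider_trk' C S h w : ider
  (fun t : unit_itv R => trk' C S h (cos (w * set_val t)) (sin (w * set_val t)))
  (fun t => w *: trk'' C S h (cos (w * set_val t)) (sin (w * set_val t))).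
Proof.
have := @ider_quad w 0 0 (vec3 (- (1 - C ^+ 2)) 0 (- (S * C))) (vec3 0 (1 - C) 0)
  (vec3 (2 * (1 - C ^+ 2) - 2 * (1 - C)) 0 (4 * h - 2 * S * (1 - C))) (vec3 0 (- (1 - C)) 0).
have -> : quad 0 0 (vec3 (- (1 - C ^+ 2)) 0 (- (S * C))) (vec3 0 (1 - C) 0)
  (vec3 (2 * (1 - C ^+ 2) - 2 * (1 - C)) 0 (4 * h - 2 * S * (1 - C))) (vec3 0 (- (1 - C)) 0)
  = trk' C S h.
  apply/funext => c; apply/funext => d; rewrite /quad /trk'.
  by apply: vec3P; rewrite !(vec3E, mxE) /= ; ring.
apply: ider_ext => t; congr (_ *: _); rewrite /quad /trk''.
by apply: vec3P; rewrite !(vec3E, mxE) /=; ring.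
Qed.

Lemma fam_trk (T : topologicalType) j w (C S h : T -> R) :
  continuous C -> continuous S -> continuous h ->
  fam j (fun x t => trk (C x) (S x) (h x) (cos (w * set_val t)) (sin (w * set_val t))).
Proof.
move=> cC cS ch.
have cA : continuous (fun x => 1 - C x).
  by move=> x; apply: cvgB; [exact: cvg_cst|exact: cC].
have cA2 : continuous (fun x => 1 - C x * C x).
  move=> x; apply: cvgB; first exact: cvg_cst.
  by move: x; exact: continuousM_fun.
have c2h : continuous (fun x => 2 * h x).
  by apply: continuousM_fun => //; exact: cst_continuous.
have c0 (v : R) : continuous (fun _ : T => v) by exact: cst_continuous.
have -> : (fun x (t : unit_itv R) =>
    trk (C x) (S x) (h x) (cos (w * set_val t)) (sin (w * set_val t))) =
  (fun x t => quad (vec3 (C x) 0 (2 * h x - S x)) (vec3 (1 - C x * C x) 0 (S x * C x)) 0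
  (vec3 ((1 - C x) - (1 - C x * C x)) 0 (S x * (1 - C x) - 2 * h x)) (vec3 0 (1 - C x) 0) 0
    (cos (w * set_val t)) (sin (w * set_val t))).
  apply/funext => x; apply/funext => t; rewrite /quad /trk.
  by apply: vec3P; rewrite !(vec3E, mxE) /= ; ring.
apply: fam_quad; try exact: cst_continuous; apply: continuous_vec3 => //.
- by move=> x; apply: cvgB; [exact: c2h|exact: cS].
- exact: continuousM_fun.
- by move=> x; apply: cvgB; [exact: cA|exact: cA2].
- move=> x; apply: cvgB; last exact: c2h.
  by move: x; exact: continuousM_fun.
Qed.

End Quad.

(** * Continuity of the track in its parameters *)

Lemma continuousN_fun (R : realType) (X : topologicalType) (V : normedModType R) (f : X -> V) :
  continuous f -> continuous (fun x => - f x).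
Proof. by move=> cf x; apply: cvgN; exact: cf. Qed.

(* A constant in front of [continuous], so that [cont] below can match on the head
   of the goal: [continuous f] itself is a notation for a product. *)
Definition cts (R : realType) (X : topologicalType) (f : X -> R) : Prop := continuous f.

Section Cts.
Variables (R : realType) (X : topologicalType).
Implicit Types f g : X -> R.

Lemma ctsP f : cts f -> continuous f. Proof. by []. Qed.

Lemma ctsD f g : cts f -> cts g -> cts (fun x => f x + g x).
Proof. exact: continuousD_fun. Qed.

Lemma ctsM f g : cts f -> cts g -> cts (fun x => f x * g x).
Proof. exact: continuousM_fun. Qed.

Lemma ctsN f : cts f -> cts (fun x => - f x).
Proof. exact: continuousN_fun. Qed.

Lemma ctsX f n : cts f -> cts (fun x => f x ^+ n).
Proof.
move=> cf; elim: n => [|n IH]; first exact: cst_continuous.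
by rewrite /cts; under eq_fun do rewrite exprS; exact: continuousM_fun.
Qed.

Lemma cts_cst (a : R) : cts (fun _ : X => a).
Proof. exact: cst_continuous. Qed.

End Cts.

Ltac cont := apply: ctsP; repeat match goal with
  | H : cts ?f |- cts ?f => exact H
  | H : cts ?f |- cts (fun x => ?f x) => exact H
  | |- cts (fun x => (@?f x) + (@?g x)) => apply (@ctsD _ _ f g)
  | |- cts (fun x => (@?f x) * (@?g x)) => apply (@ctsM _ _ f g)
  | |- cts (fun x => - (@?f x)) => apply (@ctsN _ _ f)
  | |- cts (fun x => (@?f x) ^+ _) => apply (@ctsX _ _ f)
  | |- cts (fun _ => ?a) => apply (@cts_cst _ _ a)
  end.

Section ContTrack.
Variables (R : realType) (X : topologicalType) (C S h c d : X -> R).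
Hypotheses (cC : cts C) (cS : cts S) (ch : cts h) (cc : cts c) (cd : cts d).

Lemma continuous_trk : continuous (fun x => trk (C x) (S x) (h x) (c x) (d x)).
Proof. by apply: continuous_vec3; cont. Qed.

Lemma continuous_trk' : continuous (fun x => trk' (C x) (S x) (h x) (c x) (d x)).
Proof. by apply: continuous_vec3; cont. Qed.

Lemma continuous_trk'' : continuous (fun x => trk'' (C x) (S x) (h x) (c x) (d x)).
Proof. by apply: continuous_vec3; cont. Qed.

Lemma continuous_pole : continuous (fun x => pole (C x) (S x) (c x) (d x)).
Proof. by apply: continuous_vec3; cont. Qed.

End ContTrack.

(** The phase (cos(om t), sin(om t)) is freed into an arbitrary point of the circle, so that the
    estimates run over a compact set independent of the frequency. *)
Definition circle (R : realType) : set (R * R) := [set p | p.1 ^+ 2 + p.2 ^+ 2 = 1].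

Lemma compact_circle (R : realType) : compact (@circle R).
Proof.
have cB : compact (`[-1, 1]%classic `*` `[-1, 1]%classic : set (R * R)).
  by apply: compact_setX; exact: segment_compact.
apply: (subclosed_compact _ cB).
  have cf : continuous (fun p : R * R => p.1 ^+ 2 + p.2 ^+ 2).
    have c1 : cts (@fst R R) by exact: continuous_fst.
    have c2 : cts (@snd R R) by exact: continuous_snd.
    cont.
  have -> : @circle R = (fun p : R * R => p.1 ^+ 2 + p.2 ^+ 2) @^-1` [set x | x = 1] by [].
  by apply: preimage_closed; [move=> p _; exact: cf|exact: closed_eq].
move=> [a b]; rewrite /circle /= => h; split; rewrite /= in_itv /=; apply/andP; split; nra.
Qed.

(** * Estimates at high frequency *)

Section Coil.
Variables (R : realType) (T : topologicalType) (cT : compact [set: T]).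
Local Notation V := 'cV[R]_3.
Variables (w w' : 'I_3 -> T -> unit_itv R -> V).
Hypothesis cw : forall i, continuous (fun p : T * unit_itv R => w i p.1 p.2).
Hypothesis cw' : forall i, continuous (fun p : T * unit_itv R => w' i p.1 p.2).
Hypothesis w_gt0 : forall x t, 0 < trip (w 0 x t) (w 1 x t) (w 2%:R x t).

Local Notation X := (T * unit_itv R * (R * R))%type.
Let A : set X := [set: T * unit_itv R] `*` @circle R.

Let compactA : compact A.
Proof.
apply: compact_setX; last exact: compact_circle.
by rewrite -setXTT; apply: compact_setX => //; exact: compact_itv.
Qed.

(** The determinant expands as om E + G, with E the frame determinant times 1 - C, by [trip_pole0]
    before the lift and [trip_pole1] during it. Where C = 1 the track is e1 and the pole e3, so G is
    the determinant of [w 0], [w' 0], [w 2], positive by hypothesis. *)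
Lemma coil_immersed (C S h : T -> R) :
  continuous C -> continuous S -> continuous h ->
  (forall x, C x ^+ 2 + S x ^+ 2 = 1) -> (forall x, C x <= 1) ->
  (forall x, h x = 0 \/ C x = -1 /\ S x = 0) ->
  (forall x, C x = 1 -> S x = 0 /\ h x = 0) ->
  (forall x t, 0 < trip (w 0 x t) (w' 0 x t) (w 2%:R x t)) ->
  \forall om \near +oo, forall x t c d, c ^+ 2 + d ^+ 2 = 1 ->
  0 < trip (mix (trk (C x) (S x) (h x) c d) (fun i => w i x t))
    (om *: mix (trk' (C x) (S x) (h x) c d) (fun i => w i x t) +
      mix (trk (C x) (S x) (h x) c d) (fun i => w' i x t))
    (mix (pole (C x) (S x) c d) (fun i => w i x t)).
Proof.
move=> cC cS ch CS C1 hCS C1_0 hG.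
have c12 : continuous (fun p : X => p.1) by exact: continuous_fst.
have c2 : continuous (fun p : X => p.2) by exact: continuous_snd.
have c1 : continuous (fun p : X => p.1.1) by apply: continuous_after c12; exact: continuous_fst.
have cc : continuous (fun p : X => p.2.1) by apply: continuous_after c2; exact: continuous_fst.
have cd : continuous (fun p : X => p.2.2) by apply: continuous_after c2; exact: continuous_snd.
have cCX : cts (fun p : X => C p.1.1) by exact: continuous_after cC c1.
have cSX : cts (fun p : X => S p.1.1) by exact: continuous_after cS c1.
have chX : cts (fun p : X => h p.1.1) by exact: continuous_after ch c1.
have cwX i : continuous (fun p : X => w i p.1.1 p.1.2) by apply: (continuous_after (@cw i) c12).
have cwX' i : continuous (fun p : X => w' i p.1.1 p.1.2) by apply: (continuous_after (@cw' i) c12).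
pose E (p : X) := trip (w 0 p.1.1 p.1.2) (w 1 p.1.1 p.1.2) (w 2%:R p.1.1 p.1.2) * (1 - C p.1.1).
pose G (p : X) := let k := trk (C p.1.1) (S p.1.1) (h p.1.1) p.2.1 p.2.2 in
  trip (mix k (fun i => w i p.1.1 p.1.2)) (mix k (fun i => w' i p.1.1 p.1.2))
    (mix (pole (C p.1.1) (S p.1.1) p.2.1 p.2.2) (fun i => w i p.1.1 p.1.2)).
have cE : continuous E.
  by apply: continuousM_fun; [exact: continuous_trip|cont].
have ct := continuous_trk cCX cSX chX cc cd.
have cp := continuous_pole cCX cSX cc cd.
have cG : continuous G.
  exact: (continuous_trip (continuous_mix ct cwX) (continuous_mix ct cwX')
    (continuous_mix cp cwX)).
have E0 p : A p -> 0 <= E p.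
  by move=> _; rewrite mulr_ge0// ?subr_ge0// ltW.
have EG p : A p -> E p = 0 -> 0 < G p.
  move=> _ /eqP; rewrite mulf_eq0 gt_eqF//= subr_eq0 => /eqP/esym C1p.
  have [S0 h0] := C1_0 _ C1p; rewrite /G C1p S0 h0.
  rewrite (_ : trk _ _ _ _ _ = vec3 1 0 0); last first.
    by apply: vec3P; rewrite /trk !vec3E; ring.
  rewrite (_ : pole _ _ _ _ = vec3 0 0 1); last first.
    by apply: vec3P; rewrite /pole !vec3E; ring.
  by rewrite !mix_e1 mix_e3.
apply: filterS (pos_large compactA cE cG E0 EG) => om H x t c d cd1.
rewrite tripD trip_mix_mix.
suff -> : trip (trk (C x) (S x) (h x) c d) (trk' (C x) (S x) (h x) c d)
    (pole (C x) (S x) c d) = 1 - C x by exact: (H (x, t, (c, d))).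
case: (hCS x) => [->|[-> ->]]; first exact: trip_pole0.
by rewrite trip_pole1//; ring.
Qed.

(** Dividing the derivatives by om and om^2 leaves a determinant continuous in 1 / om, whose value
    at 0 is 8 times the frame determinant; [pos_small] applies there. *)
Lemma coil_convex (w'' : 'I_3 -> T -> unit_itv R -> V) :
  (forall i, continuous (fun p : T * unit_itv R => w'' i p.1 p.2)) ->
  \forall om \near +oo, forall x t c d, c ^+ 2 + d ^+ 2 = 1 ->
  0 < trip (mix (trk (-1) 0 1 c d) (fun i => w i x t))
    (om *: mix (trk' (-1) 0 1 c d) (fun i => w i x t) +
      mix (trk (-1) 0 1 c d) (fun i => w' i x t))
    (om ^+ 2 *: mix (trk'' (-1) 0 1 c d) (fun i => w i x t) +
      (2 * om) *: mix (trk' (-1) 0 1 c d) (fun i => w' i x t) +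
      mix (trk (-1) 0 1 c d) (fun i => w'' i x t)).
Proof.
move=> cw''.
pose D (q : R * X) := let p := q.2 in let c := p.2.1 in let d := p.2.2 in
  trip (mix (trk (-1) 0 1 c d) (fun i => w i p.1.1 p.1.2))
    (mix (trk' (-1) 0 1 c d) (fun i => w i p.1.1 p.1.2) +
      q.1 *: mix (trk (-1) 0 1 c d) (fun i => w' i p.1.1 p.1.2))
    (mix (trk'' (-1) 0 1 c d) (fun i => w i p.1.1 p.1.2) +
      (2 * q.1) *: mix (trk' (-1) 0 1 c d) (fun i => w' i p.1.1 p.1.2) +
      q.1 ^+ 2 *: mix (trk (-1) 0 1 c d) (fun i => w'' i p.1.1 p.1.2)).
have cD : continuous D.
  have c1 : cts (fun q : R * X => q.1) by exact: continuous_fst.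
  have c2 : continuous (fun q : R * X => q.2) by exact: continuous_snd.
  have c21 : continuous (fun q : R * X => q.2.1) by apply: continuous_after c2; exact: continuous_fst.
  have c22 : continuous (fun q : R * X => q.2.2) by apply: continuous_after c2; exact: continuous_snd.
  have cc : continuous (fun q : R * X => q.2.2.1) by apply: continuous_after c22; exact: continuous_fst.
  have cd : continuous (fun q : R * X => q.2.2.2) by apply: continuous_after c22; exact: continuous_snd.
  have k0 (a : R) : continuous (fun _ : R * X => a) by exact: cst_continuous.
  have cwX i : continuous (fun q : R * X => w i q.2.1.1 q.2.1.2) by apply: (continuous_after (@cw i) c21).
  have cwX' i : continuous (fun q : R * X => w' i q.2.1.1 q.2.1.2) by apply: (continuous_after (@cw' i) c21).
  have cwX'' i : continuous (fun q : R * X => w'' i q.2.1.1 q.2.1.2) by apply: (continuous_after (@cw'' i) c21).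
  have ct := continuous_trk (k0 (-1)) (k0 0) (k0 1) cc cd.
  have ct' := continuous_trk' (k0 (-1)) (k0 0) (k0 1) cc cd.
  have ct'' := continuous_trk'' (k0 (-1)) (k0 0) (k0 1) cc cd.
  have c2e : continuous (fun q : R * X => 2 * q.1) by cont.
  have ce2 : continuous (fun q : R * X => q.1 ^+ 2) by cont.
  exact: (continuous_trip (continuous_mix ct cwX)
    (continuousD_fun (continuous_mix ct' cwX) (continuousZ_fun c1 (continuous_mix ct cwX')))
    (continuousD_fun (continuousD_fun (continuous_mix ct'' cwX)
      (continuousZ_fun c2e (continuous_mix ct' cwX')))
      (continuousZ_fun ce2 (continuous_mix ct cwX'')))).
have D0 p : A p -> 0 < D (0, p).
  move=> [_ hp]; rewrite /D /= mulr0 expr0n /= !scale0r !addr0.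
  by rewrite trip_mix_mix trip_convex// mulr1 mulr_gt0.
have [e /= e0 he] : exists2 e : R, 0 < e & forall z, `|z| < e -> forall p, A p -> 0 < D (z, p).
  have /nbhs_ballP[e /= e0 he] := pos_small compactA cD D0.
  by exists e => // z hz; apply: he; rewrite /ball /= sub0r normrN.
near=> om => x t c d cd1.
have om0 : 0 < om by near: om; apply: nbhs_pinfty_gt; exact: num_real.
have ome : e^-1 < om by near: om; apply: nbhs_pinfty_gt; exact: num_real.
have := he om^-1 _ (x, t, (c, d)) (conj I cd1).
rewrite gtr0_norm ?invr_gt0// invf_plt ?posrE// => /(_ ome).
rewrite /D /=; set a := mix _ _; set b := mix _ _; set a' := mix _ _.
set a'' := mix (trk'' _ _ _ _ _) _; set b' := mix (trk' _ _ _ _ _) _; set a2 := mix _ _.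
move=> H.
have E1 (u v : V) : om *: u + v = om *: (u + om^-1 *: v).
  by rewrite scalerDr scalerA divff ?gt_eqF// scale1r.
have E2 (u v z : V) : om ^+ 2 *: u + (2 * om) *: v + z =
    om ^+ 2 *: (u + (2 / om) *: v + om^-1 ^+ 2 *: z).
  rewrite !scalerDr !scalerA exprVn divff ?expf_neq0 ?gt_eqF// scale1r.
  by congr (_ + _ *: _ + _); field; rewrite gt_eqF.
rewrite E1 E2.
have -> u v z (k l : R) : trip u (k *: v) (l *: z) = k * l * trip u v z.
  by rewrite /trip /dot /cross !vec3E !mxE; ring.
by rewrite !mulr_gt0// exprn_gt0.
Unshelve. all: by end_near. Qed.

End Coil.

(** * Radial projection to the sphere *)

Section Normalize.
Variable R : realType.
Local Notation V := 'cV[R]_3.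
Implicit Types u v : V.

Lemma dotC u v : dot u v = dot v u.
Proof. by rewrite /dot; ring. Qed.

Lemma dotE u v : dot u v = (u^T *m v) 0 0.
Proof. by rewrite mxE sum3 !mxE. Qed.

Definition nrm u : V := isqrt (dot u u) *: u.

Lemma isqrt_gt0 (a : R) : 0 < a -> 0 < isqrt a.
Proof. by move=> a0; rewrite invr_gt0 sqrtr_gt0. Qed.

Lemma isqrt1 : isqrt (1 : R) = 1.
Proof. by rewrite /isqrt sqrtr1 invr1. Qed.

Lemma dot_nrm u : 0 < dot u u -> dot (nrm u) (nrm u) = 1.
Proof.
move=> u0; have -> : dot (nrm u) (nrm u) = isqrt (dot u u) ^+ 2 * dot u u.
  by rewrite /nrm /dot !mxE; ring.
by rewrite /isqrt exprVn sqr_sqrtr ?ltW// mulVf// gt_eqF.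
Qed.

Lemma nrm_id u : dot u u = 1 -> nrm u = u.
Proof. by rewrite /nrm => ->; rewrite isqrt1 scale1r. Qed.

Definition nrm' u v : V :=
  (- 2^-1 * ((dot v u + dot u v) * isqrt (dot u u) ^+ 3)) *: u + isqrt (dot u u) *: v.

Lemma ider_nrm (y y1 : unit_itv R -> V) : (forall t, 0 < dot (y t) (y t)) ->
  ider y y1 -> ider (fun t => nrm (y t)) (fun t => nrm' (y t) (y1 t)).
Proof.
move=> y0 dy.
exact: (ider_bil (bil_scale V) (ider_isqrt y0 (ider_bil (bil_dot R) dy dy)) dy).
Qed.

Lemma fam_nrm (T : topologicalType) j (y : T -> unit_itv R -> V) :
  (forall x t, 0 < dot (y x t) (y x t)) -> fam j y -> fam j (fun x t => nrm (y x t)).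
Proof.
move=> y0 hy; apply: famZ => //; apply: fam_isqrt => //.
exact: (fam_bil (bil_dot R)).
Qed.

Lemma nrm'_orth u v : dot u u = 1 -> dot u v = 0 -> nrm' u v = v.
Proof.
move=> u1 uv; rewrite /nrm' u1 (dotC v) uv addr0 mul0r mulr0 scale0r add0r.
by rewrite isqrt1 scale1r.
Qed.

Lemma trip0l u v : trip 0 u v = 0.
Proof. by rewrite /trip /dot !mxE !mul0r !addr0. Qed.

Lemma trip0m u v : trip u 0 v = 0.
Proof. by rewrite /trip /dot /cross !vec3E !mxE; ring. Qed.

Lemma trip_neq0 u v w : 0 < trip u v w -> 0 < dot u u.
Proof. by move=> h; apply: dot_gt0 => u0; move: h; rewrite u0 trip0l ltxx. Qed.

(** Projecting adds to the velocity a multiple of [u], which the determinant ignores. *)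
Lemma trip_nrm' u v w : trip u (nrm' u v) w = isqrt (dot u u) * trip u v w.
Proof.
have E k l : trip u (k *: u + l *: v) w = l * trip u v w.
  by rewrite /trip /dot /cross !vec3E !mxE; ring.
exact: E.
Qed.

(** The arguments are y, y', y'' rescaled by a function l with derivatives l1, l2, as Leibniz gives
    them; column operations remove l1 and l2. A positive factor thus preserves local convexity. *)
Lemma trip_scaled u v w (l l1 l2 : R) :
  trip (l *: u) (l1 *: u + l *: v) (l2 *: u + l1 *: v + (l1 *: v + l *: w)) =
  l ^+ 3 * trip u v w.
Proof. by rewrite /trip /dot /cross !vec3E !mxE; ring. Qed.

Lemma trip_cross u v z : trip u v (cross u z) = dot u u * dot v z - dot u z * dot u v.
Proof. by rewrite /trip /dot /cross !vec3E; ring. Qed.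

(** By [trip_cross] the second determinant is v . z, and the first is the squared length of the part
    of z orthogonal to u; that part is nonzero because its product with v is v . z. *)
Lemma frame_gt0 u v z : dot u u = 1 -> dot u v = 0 -> 0 < dot v z ->
  0 < trip u z (cross u z) /\ 0 < trip u v (cross u z).
Proof.
move=> u1 uv vz; rewrite !trip_cross u1 uv mulr0 subr0 !mul1r; split=> //.
have -> : dot z z - dot u z * dot u z =
    dot (z - dot u z *: u) (z - dot u z *: u).
  have -> : dot (z - dot u z *: u) (z - dot u z *: u) =
      dot z z - 2 * dot u z * dot u z + dot u z ^+ 2 * dot u u.
    by rewrite /dot !mxE; ring.
  by rewrite u1; ring.
apply: dot_gt0 => h; have : dot v (z - dot u z *: u) = dot v z - dot u z * dot u v.
  by rewrite /dot !mxE; ring.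
by rewrite h (bil0r _ (bil_dot R)) uv mulr0 subr0 => h'; rewrite -h' ltxx in vz.
Qed.

End Normalize.

(** Frequencies 2 pi N bring the coil back to its starting phase at t = 1, as the end conditions
    demand. *)
Lemma near_2piN (R : realType) (P : R -> Prop) : (\forall om \near +oo, P om) ->
  exists N : nat, P (2 * pi * N%:R).
Proof.
move=> [M [_ hM]]; exists (Num.truncn (`|M| / (2 * pi))).+1; apply: hM.
have p0 : 0 < 2 * pi :> R by rewrite mulr_gt0// pi_gt0.
apply: le_lt_trans (ler_norm M) _.
rewrite -[ltLHS](@divfK _ (2 * pi)) ?gt_eqF// mulrC ltr_pM2l//.
exact: truncnS_gt.
Qed.

Lemma cos_sin_2piN (R : realType) (N : nat) :
  cos (2 * pi * N%:R : R) = 1 /\ sin (2 * pi * N%:R : R) = 0.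
Proof.
elim: N => [|N [hc hs]]; first by rewrite mulr0 cos0 sin0.
rewrite -[N.+1%:R]natr1 mulrDr mulr1 cosD sinD hc hs.
rewrite (_ : 2 * pi = pi + pi); last by ring.
by rewrite cosD sinD cospi sinpi; split; ring.
Qed.

(** * Inclination and lift as functions of the homotopy parameter *)

Section Schedule.
Variable R : realType.
Implicit Types s : unit_itv R.

(** This is sin^2(i / 2) for the inclination i, whence cos i = 1 - 2 p and sin i = 2 sqrt(p (1 -
    p)). The root is not smooth at the ends, but only continuity in s is at stake. *)
Definition phase s : R := Num.min (2 * set_val s) 1.
Definition schedC s : R := 1 - 2 * phase s.
Definition schedS s : R := 2 * Num.sqrt (phase s * (1 - phase s)).
Definition schedh s : R := Num.max 0 (2 * set_val s - 1).

Lemma phase_ge0 s : 0 <= phase s.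
Proof. by rewrite /phase le_min ler01 andbT mulr_ge0// itv_ge0. Qed.

Lemma phase_le1 s : phase s <= 1.
Proof. by rewrite /phase ge_min lexx orbT. Qed.

Lemma sched_circle s : schedC s ^+ 2 + schedS s ^+ 2 = 1.
Proof.
rewrite /schedS exprMn sqr_sqrtr; first by rewrite /schedC; ring.
by rewrite mulr_ge0 ?phase_ge0// subr_ge0 phase_le1.
Qed.

Lemma schedC_le1 s : schedC s <= 1.
Proof. by rewrite /schedC; have := phase_ge0 s; lra. Qed.

Lemma sched_phase s : schedh s = 0 \/ schedC s = -1 /\ schedS s = 0.
Proof.
rewrite /schedh /schedC /schedS /phase; have [h|h] := leP (2 * set_val s : R) 1.
  by left; rewrite max_l// subr_le0.
by right; rewrite subrr mulr0 sqrtr0 mulr0 mulr1; split=> //; ring.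
Qed.

Lemma sched_start s : schedC s = 1 -> schedS s = 0 /\ schedh s = 0.
Proof.
move=> h; have s0 : phase s = 0 by move: h; rewrite /schedC; lra.
split; first by rewrite /schedS s0 mul0r sqrtr0 mulr0.
have [//|[h1 _]] := sched_phase s; move: h; rewrite h1 => h.
by exfalso; lra.
Qed.

Lemma sched0 : schedC (I0 R) = 1.
Proof. by rewrite /schedC /phase /= mulr0 min_l ?ler01// mulr0 subr0. Qed.

Lemma sched1 : [/\ schedC (I1 R) = -1, schedS (I1 R) = 0 & schedh (I1 R) = 1].
Proof.
have E : phase (I1 R) = 1 by rewrite /phase /= mulr1 min_r// ler1n.
split; first by rewrite /schedC E; ring.
  by rewrite /schedS E subrr mulr0 sqrtr0 mulr0.
by rewrite /schedh /= mulr1 max_r; [ring|rewrite subr_ge0 ler1n].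
Qed.

Lemma continuous_phase : continuous phase.
Proof.
apply: min_fun_continuous; last exact: cst_continuous.
by apply: continuousM_fun; [exact: cst_continuous|exact: continuous_itv_val].
Qed.

Lemma continuous_schedC : continuous schedC.
Proof. by have cs : cts phase := continuous_phase; rewrite /schedC; cont. Qed.

Lemma continuous_schedS : continuous schedS.
Proof.
have cs : cts phase := continuous_phase.
have c1 : continuous (fun s => phase s * (1 - phase s)) by cont.
apply: continuousM_fun; first exact: cst_continuous.
by apply: continuous_after c1; exact: sqrt_continuous.
Qed.

Lemma continuous_schedh : continuous schedh.
Proof.
apply: max_fun_continuous; first exact: cst_continuous.
have cv : cts (fun s => set_val s : R) := @continuous_itv_val R.
by cont.
Qed.

End Schedule.

(** * The moving frame and the wire *)

Section Frame.
Variables (R : realType) (T : topologicalType) (cT : compact [set: T]).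
Local Notation V := 'cV[R]_3.

(* The frame (c, b, c x b) along the curve loses no derivative, although [b]
   replaces the tangent direction. *)
Lemma moving_frame (r : option nat) (c c' : T -> unit_itv R -> V) :
  reg_le 2 r -> (forall j, reg_le j r -> fam j c) ->
  (forall x, ider (c x) (c' x)) ->
  (forall x t, dot (c x t) (c x t) = 1) -> (forall x t, c' x t <> 0) ->
  exists w w' w'' : 'I_3 -> T -> unit_itv R -> V,
  [/\ [/\ forall i j, reg_le j r -> fam j (w i),
          forall i x, ider (w i x) (w' i x), forall i x, ider (w' i x) (w'' i x),
          forall i, fam 1 (w' i) & forall i, fam 0 (w'' i)],
      w 0 = c /\ w' 0 = c',
      (forall x, w 1 x (I0 R) = c' x (I0 R)) /\ (forall x, w 1 x (I1 R) = c' x (I1 R)) &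
      (forall x t, 0 < trip (w 0 x t) (w 1 x t) (w 2%:R x t)) /\
      (forall x t, 0 < trip (w 0 x t) (w' 0 x t) (w 2%:R x t))].
Proof.
move=> hr hc dc c1 c'0.
have hc' : fam 1 c' by apply: famS dc; exact: hc.
have cc' x t : dot (c x t) (c' x t) = 0.
  have H := ider_bil (bil_dot R) (dc x) (dc x).
  have K : ider (fun t => dot (c x t) (c x t)) (fun=> 0 : R).
    have -> : (fun t => dot (c x t) (c x t)) = fun=> 1 by apply/funext => s; exact: c1.
    exact: ider_cst.
  have := congr1 (fun f => f t) (ider_unique H K) => /=.
  by rewrite (dotC (c' x t)); lra.
have [b [hb cb b0 b1]] := smooth_direction cT (fam_cont hc') c'0.
pose n x t := cross (c x t) (b x t).
pose w (i : 'I_3) := if i == 0 then c else if i == 1 then b else n.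
have hw i j : reg_le j r -> fam j (w i).
  move=> hj; rewrite /w; case: ifP => _; first exact: hc.
  case: ifP => _; first exact: hb.
  by apply: (fam_bil (bil_cross R)); [exact: hc|exact: hb].
have /choice[w' hw'] : forall i, exists w1, (forall x, ider (w i x) (w1 x)) /\ fam 1 w1.
  by move=> i; have [_ [w1 h]] := hw i 2 hr; exists w1.
have /choice[w'' hw''] : forall i, exists w2, (forall x, ider (w' i x) (w2 x)) /\ fam 0 w2.
  by move=> i; have [_ [_ [w2 h]]] := hw' i; exists w2.
have w'0 : w' 0 = c'.
  by apply/funext => x; exact: ider_unique ((hw' 0).1 x) (dc x).
exists w, w', w''; split=> //.
- split=> //; first by move=> i; exact: (hw' i).1.
  + by move=> i; exact: (hw'' i).1.
  + by move=> i; exact: (hw' i).2.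
  + by move=> i; exact: (hw'' i).2.
- by split=> x t; rewrite ?w'0; have [] := frame_gt0 (c1 x t) (cc' x t) (cb x t).
Qed.

End Frame.

Section Wire.
Variables (R : realType) (T : topologicalType) (r : option nat) (om : R).
Local Notation V := 'cV[R]_3.
Variables (C S h : T -> R) (w w' w'' : 'I_3 -> T -> unit_itv R -> V).
Hypotheses (cC : continuous C) (cS : continuous S) (ch : continuous h).
Hypothesis hw : forall i j, reg_le j r -> fam j (w i).
Hypothesis dw : forall i x, ider (w i x) (w' i x).
Hypothesis dw' : forall i x, ider (w' i x) (w'' i x).

Definition wire x t : V := mix (trk (C x) (S x) (h x) (cos (om * set_val t))
  (sin (om * set_val t))) (fun i => w i x t).

Definition wire' x t : V :=
  om *: mix (trk' (C x) (S x) (h x) (cos (om * set_val t)) (sin (om * set_val t)))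
    (fun i => w i x t) +
  mix (trk (C x) (S x) (h x) (cos (om * set_val t)) (sin (om * set_val t)))
    (fun i => w' i x t).

Definition wire'' x t : V :=
  om ^+ 2 *: mix (trk'' (C x) (S x) (h x) (cos (om * set_val t)) (sin (om * set_val t)))
    (fun i => w i x t) +
  (2 * om) *: mix (trk' (C x) (S x) (h x) (cos (om * set_val t)) (sin (om * set_val t)))
    (fun i => w' i x t) +
  mix (trk (C x) (S x) (h x) (cos (om * set_val t)) (sin (om * set_val t)))
    (fun i => w'' i x t).

Lemma fam_wire j : reg_le j r -> fam j wire.
Proof. by move=> hj; apply: fam_mix; [exact: fam_trk|move=> i; exact: hw]. Qed.

Lemma ider_wire x : ider (wire x) (wire' x).
Proof.
apply: ider_ext (ider_mix (@ider_trk R (C x) (S x) (h x) om) (fun i => dw i x)) => t /=.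
by rewrite mixZ.
Qed.

Lemma ider_wire' x : ider (wire' x) (wire'' x).
Proof.
have H := iderD (ider_bil (bil_scale V) (ider_cst om)
   (ider_mix (@ider_trk' R (C x) (S x) (h x) om) (fun i => dw i x)))
  (ider_mix (@ider_trk R (C x) (S x) (h x) om) (fun i => dw' i x)).
apply: ider_ext H => t /=.
rewrite /wire'' scale0r add0r !mixZ scalerDr scalerA -!addrA; congr (_ + _).
by rewrite addrA -scalerDl -mulr2n mulr_natl.
Qed.

Lemma wire_unit x t : C x = 1 -> S x = 0 -> h x = 0 -> wire x t = w 0 x t.
Proof.
move=> C1 S0 h0; rewrite /wire C1 S0 h0.
have E c d : trk 1 0 0 c d = vec3 1 0 0 :> V by apply: vec3P; rewrite /trk !vec3E; ring.
by rewrite E mix_e1.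
Qed.

(** At phase (1, 0) the satellite is over e1 and moves along e2 with speed 1 - C, whatever the
    inclination and the lift. *)
Lemma wire_end x t : cos (om * set_val t) = 1 -> sin (om * set_val t) = 0 ->
  wire x t = w 0 x t /\ wire' x t = (om * (1 - C x)) *: w 1 x t + w' 0 x t.
Proof.
move=> c1 s0; have Et : trk (C x) (S x) (h x) 1 0 = vec3 1 0 0.
  by apply: vec3P; rewrite /trk !vec3E; ring.
have Et' : trk' (C x) (S x) (h x) 1 0 = vec3 0 (1 - C x) 0.
  by apply: vec3P; rewrite /trk' !vec3E; ring.
by rewrite /wire /wire' c1 s0 Et Et' !mix_e1 mix_e2 scalerA.
Qed.

End Wire.

(** * End conditions and conclusion *)

Lemma SO3_cols (R : realType) (Q : 'M[R]_3) : SO3 Q ->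
  dot (Q *m e1 R) (Q *m e1 R) = 1 /\ dot (Q *m e1 R) (Q *m e2 R) = 0.
Proof.
move=> [QQ _]; rewrite !dotE !trmx_mul -!mulmxA (mulmxA _ Q) (mulmxA _ Q) QQ !mul1mx.
by rewrite -!dotE /dot /e1 /e2 !mxE /=; split; ring.
Qed.

(** Makes the condition at t = 0 the case Q = 1 of the condition at t = 1. *)
Lemma SO3_1 (R : realType) : SO3 (1%:M : 'M[R]_3).
Proof. by split; rewrite ?trmx1 ?mul1mx ?det1. Qed.

(** At an endpoint b and c' coincide, so the velocity of the wire is a positive multiple of v; being
    tangent at a unit vector, it is unchanged by the projection. *)
Lemma wire_boundary (R : realType) (y1 u v w1 w0' : 'cV[R]_3) (om C a : R) :
  0 <= om -> C <= 1 -> 0 < a -> w1 = a *: v -> w0' = a *: v ->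
  y1 = (om * (1 - C)) *: w1 + w0' -> dot u u = 1 -> dot u v = 0 ->
  nrm u = u /\ exists c : R, 0 < c /\ nrm' u y1 = c *: v.
Proof.
move=> om0 C1 a0 -> -> -> uu uv; split; first exact: nrm_id.
exists ((om * (1 - C) + 1) * a); split.
  by rewrite mulr_gt0// ltr_wpDl// mulr_ge0// subr_ge0.
rewrite nrm'_orth//; first by rewrite scalerA mulrDl mul1r scalerDl.
by rewrite scalerA -scalerDl -[_ *: v]addr0 (bil_r (bil_dot R)) uv
  (bil0r _ (bil_dot R)) scaler0 addr0.
Qed.

Unset Implicit Arguments.

Theorem theorem1 (R : realType) (r : option nat) (hr : reg_le 2 r)
    (Q : 'M[R]_3) (hQ : SO3 Q) (K : topologicalType)
    (hK : compact [set: K]) (f : K -> YQ r Q) (hf : continuous f) :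
  exists (g : K -> XQ r Q) (H : unit_itv R * K -> YQ r Q),
    [/\ continuous g, continuous H,
        (forall k, H (I0 R, k) = f k) &
        (forall k, H (I1 R, k) = iQ (g k))].
Proof.
(* The homotopy parameter joins the parameter space, so continuity of [H] is that of a single family
   over a compact space. *)
pose T := (unit_itv R * K)%type.
have cT : compact [set: T].
  by rewrite -setXTT; apply: compact_setX => //; exact: compact_itv.
pose fT (x : T) : Cr_space R r := set_val (f x.2).
have cfT : continuous fT.
  have ci : continuous (set_val : YQ r Q -> Cr_space R r) by exact: initial_continuous.
  apply: (continuous_after ci); apply: (continuous_after hf); exact: continuous_snd.
pose c x := sval (fT x).
have hc j : reg_le j r -> fam j c by exact: (@fam_of_Cr _ _ _ _ cfT j 0).
pose c' x := curve_derive (c x).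
have dc x : ider (c x) (c' x).
  have [_ [c1 [d1 _]]] := hc 2 hr; have [_ E] := ider_curve (d1 x).
  by rewrite /c' E.
have hY (x : T) : YQ r Q (fT x) := set_valP (f x.2).
have c1 x t : dot (c x t) (c x t) = 1.
  by have [/(_ t) + _ _ _] := hY x; rewrite /sphere /= sum3 !expr2.
have c'0 x t : c' x t <> 0 by have [_ + _ _] := hY x; exact.
have [w [w' [w'' [[hw dw dw' hw' hw''] [w0 w'0] [w1I0 w1I1] [wp wp']]]]] :=
  moving_frame cT hr hc dc c1 c'0.
pose C (x : T) := schedC x.1; pose S (x : T) := schedS x.1; pose h (x : T) := schedh x.1.
have cfst : continuous (fun x : T => x.1) by exact: continuous_fst.
have cC : continuous C by exact: (continuous_after (@continuous_schedC R) cfst).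
have cS : continuous S by exact: (continuous_after (@continuous_schedS R) cfst).
have ch : continuous h by exact: (continuous_after (@continuous_schedh R) cfst).
have cw i : continuous (fun p : T * unit_itv R => w i p.1 p.2) := fam_cont (hw i 2 hr).
have cw' i : continuous (fun p : T * unit_itv R => w' i p.1 p.2) := fam_cont (hw' i).
have cw'' i : continuous (fun p : T * unit_itv R => w'' i p.1 p.2) := fam_cont (hw'' i).
have imm := coil_immersed cT cw cw' wp cC cS ch (fun x => sched_circle x.1)
  (fun x => schedC_le1 x.1) (fun x => sched_phase x.1) (fun x => @sched_start R x.1) wp'.
pose at1 (p : K * unit_itv R) : T * unit_itv R := ((I1 R, p.1), p.2).
have cat1 : continuous at1.
  apply: continuous_pair; last exact: continuous_snd.
  by apply: continuous_pair; [exact: cst_continuous|exact: continuous_fst].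
(* Convexity is sought only on the slice s = 1, hence with parameter space [K]. *)
have cvx := coil_convex hK (w := fun i k => w i (I1 R, k)) (w' := fun i k => w' i (I1 R, k))
  (w'' := fun i k => w'' i (I1 R, k)) (fun i => continuous_after (cw i) cat1)
  (fun i => continuous_after (cw' i) cat1) (fun k => wp (I1 R, k))
  (fun i => continuous_after (cw'' i) cat1).
have [N [immN cvxN]] := near_2piN (filterI imm cvx).
set om := 2 * pi * N%:R in immN cvxN.
have om0 : 0 <= om by rewrite !mulr_ge0// pi_ge0.
pose y := wire om C S h w; pose y' := wire' om C S h w w'.
pose y'' := wire'' om C S h w w' w''.
have dy x : ider (y x) (y' x) by exact: ider_wire.
have dy' x : ider (y' x) (y'' x) by exact: ider_wire'.
have cs1 (t : unit_itv R) : cos (om * set_val t) ^+ 2 + sin (om * set_val t) ^+ 2 = 1 :> R.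
  exact: cos2Dsin2.
have immy x t := immN x t _ _ (cs1 t).
have y0 x t : 0 < dot (y x t) (y x t) := trip_neq0 (immy x t).
have hd j : reg_le j r -> fam j (fun x t => nrm (y x t)).
  by move=> hj; apply: (fam_nrm y0); exact: (fam_wire om cC cS ch hw hj).
have dd x := ider_nrm (y0 x) (dy x).
have Ed x : curve_derive (fun t => nrm (y x t)) = fun t => nrm' (y x t) (y' x t).
  by have [] := ider_curve (dd x).
pose F (x : T) : Cr_space R r := exist _ (fun t => nrm (y x t)) (mem_set (Cr_of_fam hd x)).
have [hN1 hN0] := cos_sin_2piN R N.
have end0 x : y x (I0 R) = w 0 x (I0 R) /\
    y' x (I0 R) = (om * (1 - C x)) *: w 1 x (I0 R) + w' 0 x (I0 R).
  by apply: wire_end; rewrite mulr0 ?cos0 ?sin0.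
have end1 x : y x (I1 R) = w 0 x (I1 R) /\
    y' x (I1 R) = (om * (1 - C x)) *: w 1 x (I1 R) + w' 0 x (I1 R).
  by apply: wire_end; rewrite mulr1.
have FY x : YQ r Q (F x).
  have [_ _ [p0 [a0 [a0_gt0 v0]]] [p1 [a1 [a1_gt0 v1]]]] := hY x.
  have {}p0 : c x (I0 R) = e1 R := p0; have {}p1 : c x (I1 R) = Q *m e1 R := p1.
  have {}v0 : c' x (I0 R) = a0 *: e2 R := v0.
  have {}v1 : c' x (I1 R) = a1 *: (Q *m e2 R) := v1.
  rewrite /YQ /= Ed; split.
  - by move=> t; rewrite /sphere /= sum3 !expr2; exact: dot_nrm.
  (* A zero velocity after projection would make the determinant with the pole vanish. *)
  - move=> t z; have := mulr_gt0 (isqrt_gt0 (y0 x t)) (immy x t).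
    by rewrite -trip_nrm' -/(y' x t) z trip0m ltxx.
  - have [-> ->] := end0 x.
    have [u1 uv] := SO3_cols (SO3_1 R); rewrite !mul1mx in u1 uv.
    rewrite w0 w'0 p0.
    by apply: (wire_boundary om0 (schedC_le1 x.1) a0_gt0 _ v0 erefl u1 uv); rewrite w1I0.
  - have [-> ->] := end1 x.
    have [u1 uv] := SO3_cols hQ; rewrite w0 w'0 p1.
    by apply: (wire_boundary om0 (schedC_le1 x.1) a1_gt0 _ v1 erefl u1 uv); rewrite w1I1.
pose H (x : T) : YQ r Q := exist _ (F x) (mem_set (FY x)).
have [C1 S1 h1] := sched1 R.
have hl : fam 2 (fun x t => isqrt (dot (y x t) (y x t))).
  by apply: fam_isqrt => //; apply: (fam_bil (bil_dot R)); exact: (fam_wire om cC cS ch hw hr).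
have [_ [l1 [dl [_ [l2 [dl1 _]]]]]] := hl.
have HX k : XQ r Q (H (I1 R, k)).
  move=> t; pose x : T := (I1 R, k).
  have d1 := ider_bil (bil_scale _) (dl x) (dy x).
  have d2 := iderD (ider_bil (bil_scale _) (dl1 x) (dy x)) (ider_bil (bil_scale _) (dl x) (dy' x)).
  have [_ Ed1] := ider_curve d1; have [_ Ed2] := ider_curve d2.
  rewrite -/(nrm _) in Ed1.
  rewrite det_trip [curve_derive (sval _)]Ed1 Ed2 trip_scaled mulr_gt0 ?exprn_gt0 ?isqrt_gt0//.
  have := cvxN k t _ _ (cs1 t).
  by rewrite /y /y' /y'' /wire /wire' /wire'' /C /S /h /= C1 S1 h1.
have cH : continuous H.
  by apply: continuous_comp_initial; apply: (@continuous_Cr _ _ _ F) => j hj; exact (hd j hj).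
exists (fun k => exist _ (H (I1 R, k)) (mem_set (HX k))), H; split=> //.
- apply: continuous_comp_initial.
  apply: (continuous_after cH (g := fun k => (I1 R, k))).
  by apply: continuous_pair; [exact: cst_continuous|move=> ?; exact: cvg_id].
- move=> k; apply: val_inj; apply: val_inj; apply/funext => t /=.
  (* At s = 0 the coil is constantly e1, so the wire is c, already of unit length. *)
  have [S0 h0] := sched_start (sched0 R).
  have -> : y (I0 R, k) t = c (I0 R, k) t.
    by rewrite -w0; apply: wire_unit; [exact: sched0|exact: S0|exact: h0].
  by rewrite nrm_id.
Qed.
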